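(* Let $\alpha\ge 2$ be an integer and let $F(z)=\sum_{k=1}^{\alpha-1}\overline{z}^{k}A_k(z)$ be a poly-analytic function on $U$ such that each $A_k$ is a starlike analytic function on $U$. Let $0<r<1$ and suppose $|A_k(z)|\le M(r)$ for all $|z|=r$ and each $k=1,\dots,\alpha-1$. Let $L(r)$ denote the arclength of the curve $C_r$, the image of the circle $|z|=r$ under $w=F(z)$. Then $$L(r)\le \frac{2\pi M(r)\,r}{1-r}\left[\frac{(1+r)\left((\alpha-1)r^{\alpha}-\alpha r^{\alpha-1}+1\right)}{(1-r)^2}-1+r^{\alpha-1}\right].$$
   Context: $U=\{z\in\mathbb{C}:|z|<1\}$ is the open unit disk. A univalent (injective) analytic function $A$ on $U$ is starlike analytic if $\frac{\partial \arg A(re^{i\theta})}{\partial\theta}=\mathrm{Re}\,\frac{zA'(z)}{A(z)}>0$ for all $z\in U$ (in particular $A(0)=0$, and the quotient at $z=0$ is understood as its limit). The arclength $L(r)=\int_{C_r}|dF|$ is the length of the parametrized curve $\theta\mapsto F(re^{i\theta})$, $0\le\theta\le 2\pi$. *)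

(* Defs.v *)
From Stdlib Require Export Reals.
From Coquelicot Require Export Coquelicot.
Open Scope R_scope.

Definition in_disk (z : C) : Prop := Cmod z < 1.

(* Functions on the disk are total functions [C -> C]; [d] can be taken small
   enough for the ball around [z0] to lie in the disk, so the values of [f]
   outside it are irrelevant. *)
Definition analytic_on_disk (f : C -> C) : Prop :=
  forall z0 : C, in_disk z0 ->
    exists (a : nat -> C) (d : R), 0 < d /\
      forall z : C, Cmod (z - z0) < d -> is_pseries a (z - z0)%C (f z).

Definition univalent_on_disk (f : C -> C) : Prop :=
  forall z w : C, in_disk z -> in_disk w -> f z = f w -> z = w.

(* [C_derive] is computed along the real direction; it is the complex derivative
   wherever the latter exists (is_C_derive_unique). *)
Definition starlike_quotient (A : C -> C) (z : C) : C :=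
  (z * C_derive A z / A z)%C.

(* At [z = 0] the quotient has the form 0/0 and is read as its limit.  Away from
   0, univalence and [A 0 = 0] give [A z <> 0], so the division is genuine. *)
Definition starlike_analytic (A : C -> C) : Prop :=
  analytic_on_disk A /\
  univalent_on_disk A /\
  A 0%C = 0%C /\
  (forall z : C, in_disk z -> z <> 0%C -> 0 < Re (starlike_quotient A z)) /\
  (exists l : C,
      filterlim (starlike_quotient A) (locally' (0%C : C)) (locally l) /\
      0 < Re l).

Definition curve_length (gamma : R -> C) (a b : R) : R :=
  RInt (fun t => Cmod (Derive (fun s => Re (gamma s)) t,
                       Derive (fun s => Im (gamma s)) t)) a b.

Definition circle_image (F : C -> C) (r : R) (theta : R) : C :=
  F (r * cos theta, r * sin theta).

Definition arclength (F : C -> C) (r : R) : R :=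
  curve_length (circle_image F r) 0 (2 * PI).

Definition polyanalytic_sum (n : nat) (A : nat -> C -> C) (z : C) : C :=
  sum_n_m (fun k => (Cpow (Cconj z) k * A k z)%C) 1 n.

(* Main.v *)
From Stdlib Require Import Lra Lia Psatz Classical ClassicalEpsilon List.
Require Import Defs.

(* Along z = r e^{it} the derivative of F is the sum over k of
   i conj(z)^k A_k(z) (p_k(z) - k), with p_k = z A_k' / A_k.  Each p_k has positive
   real part and value 1 at 0, so the Schwarz lemma applied to
   (p_k - 1) / (p_k + 1) gives |p_k - 1| <= 2r / (1 - r), whence
   |p_k - k| <= k (1 + r) / (1 - r) - 1; the stated bound is 2 pi times the sum
   over k of M(r) r^k (k (1 + r) / (1 - r) - 1) in closed form.  That p_k(0) = 1
   amounts to A_k'(0) <> 0, which is where univalence is used. *)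

(** * Complex power series *)

(** Two notions of regularity are kept apart. [analytic_at] passes to difference quotients and
    derivatives by acting on coefficients. The weaker [smooth_at] survives products and reciprocals
    without any rearrangement of power series, and it suffices for a maximum principle that compares
    a value with four neighbouring ones instead of using contour integrals. Removable singularities
    are handled by difference quotients with a prescribed value on the diagonal, so every function
    stays total. Since nothing is known on the unit circle itself, the Schwarz estimate is made on
    |z| = rho < 1, with bound 1 / rho, and rho then tends to 1. *)

Definition Cseries (u : nat -> C) (l : C) : Prop :=
  is_series (K := C_AbsRing) (V := C_NormedModule) u l.

Lemma is_pseries_Cseries (a : nat -> C) (h l : C) :
  is_pseries (K := C_AbsRing) (V := C_NormedModule) a h l <->
  Cseries (fun n => (a n * h ^ n)%C) l.
Proof.
assert (E : forall n, scal (K := C_AbsRing) (V := C_NormedModule) (pow_n h n) (a n)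
                      = (a n * h ^ n)%C).
{ intros n. change (pow_n (K := C_AbsRing) h n * a n = a n * h ^ n)%C.
  rewrite Cmult_comm. f_equal. }
split; intros H; (eapply is_series_ext; [|exact H]); intros n; simpl.
- apply E.
- symmetry; apply E.
Qed.

Lemma Cseries_terms_bounded (u : nat -> C) (l : C) :
  Cseries u l -> exists K, forall n, Cmod (u n) <= K.
Proof.
intros H.
destruct (filterlim_bounded (K := C_AbsRing) (V := C_NormedModule) (sum_n u)
            (ex_intro _ l H)) as [M HM].
exists (2 * M). intros [|n].
- assert (H0 := HM 0%nat). rewrite sum_O in H0.
  change (Cmod (u 0%nat) <= M) in H0. assert (H1 := Cmod_ge_0 (u 0%nat)). lra.
- assert (H1 := HM (S n)). assert (H0 := HM n). rewrite sum_Sn in H1.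
  set (s := sum_n u n) in *. change (Cmod s <= M) in H0.
  change (Cmod (s + u (S n)) <= M) in H1.
  replace (u (S n)) with ((s + u (S n)) + - s)%C by ring.
  assert (H2 := Cmod_triangle (s + u (S n)) (- s)). rewrite Cmod_opp in H2. lra.
Qed.

Lemma Cseries_exists (u : nat -> C) (K q : R) :
  0 <= q < 1 -> (forall n, Cmod (u n) <= K * q ^ n) -> exists l, Cseries u l.
Proof.
intros Hq H.
apply (ex_series_le (K := C_AbsRing) (V := C_CompleteNormedModule) u
         (fun n => K * q ^ n)).
- exact H.
- apply (ex_series_scal_l (K := R_AbsRing) (V := R_NormedModule)).
  apply ex_series_geom. rewrite Rabs_pos_eq; lra.
Qed.

Lemma Cseries_bound (u : nat -> C) (l : C) (K q : R) :
  0 <= q < 1 -> (forall n, Cmod (u n) <= K * q ^ n) -> Cseries u l ->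
  Cmod l <= K / (1 - q).
Proof.
intros Hq H Hl.
assert (HK : 0 <= K).
{ assert (H0 := H 0%nat). simpl in H0. assert (H1 := Cmod_ge_0 (u 0%nat)). lra. }
assert (Hs : forall n, Cmod (sum_n u n) <= K / (1 - q)).
{ intros n.
  (* The exact geometric partial sum is carried through the induction, because the limit value alone
     is not inductive. *)
  apply Rle_trans with (K * (1 - q ^ S n) / (1 - q)).
  - induction n as [|n IH].
    + rewrite sum_O. replace (K * (1 - q ^ 1) / (1 - q)) with (K * q ^ 0).
      apply H. simpl; field; lra.
    + rewrite sum_Sn.
      apply Rle_trans with (1 := Cmod_triangle _ _).
      assert (H1 := H (S n)).
      replace (K * (1 - q ^ S (S n)) / (1 - q))
        with (K * (1 - q ^ S n) / (1 - q) + K * q ^ S n) by (simpl; field; lra).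
      apply Rplus_le_compat; assumption.
  - unfold Rdiv. apply Rmult_le_compat_r.
    + left; apply Rinv_0_lt_compat; lra.
    + assert (0 <= q ^ S n) by (apply pow_le; lra). nra. }
assert (Hn : is_lim_seq (fun n => Cmod (sum_n u n)) (Cmod l)).
{ apply (filterlim_comp _ _ _ (sum_n u) Cmod eventually (locally l) (locally (Cmod l)) Hl).
  apply (filterlim_norm (K := C_AbsRing) (V := C_NormedModule) l). }
apply (is_lim_seq_le (fun n => Cmod (sum_n u n)) (fun _ => K / (1 - q))
         (Cmod l) (K / (1 - q)) Hs Hn (is_lim_seq_const _)).
Qed.

Definition analytic_at (f : C -> C) (z0 : C) : Prop :=
  exists (a : nat -> C) (d : R), 0 < d /\
    forall h : C, Cmod h < d -> Cseries (fun n => (a n * h ^ n)%C) (f (z0 + h)%C).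

Lemma analytic_on_disk_at (f : C -> C) (z0 : C) :
  analytic_on_disk f -> in_disk z0 -> analytic_at f z0.
Proof.
intros Hf Hz. destruct (Hf z0 Hz) as [a [d [Hd H]]].
exists a, d. split; [exact Hd|]. intros h Hh.
apply is_pseries_Cseries.
replace h with (z0 + h - z0)%C at 1 by ring.
apply H. replace (z0 + h - z0)%C with h by ring. exact Hh.
Qed.

Lemma Cseries_ext (u v : nat -> C) (l : C) :
  (forall n, u n = v n) -> Cseries u l -> Cseries v l.
Proof. intros E H. exact (is_series_ext u v l E H). Qed.

Lemma Cseries_minus (u v : nat -> C) (l m : C) :
  Cseries u l -> Cseries v m -> Cseries (fun n => u n - v n)%C (l - m)%C.
Proof. intros Hu Hv. exact (is_series_minus u v l m Hu Hv). Qed.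

Lemma Cseries_scal (c : C) (u : nat -> C) (l : C) :
  Cseries u l -> Cseries (fun n => c * u n)%C (c * l)%C.
Proof. intros Hu. exact (is_series_scal (K := C_AbsRing) (V := C_NormedModule) c u l Hu). Qed.

Lemma Cseries_tail (u : nat -> C) (l : C) :
  Cseries u l -> Cseries (fun n => u (S n)) (l - u 0%nat)%C.
Proof.
intros H. apply (is_series_incr_1 (K := C_AbsRing) (V := C_NormedModule)).
change (Cseries u (l - u 0%nat + u 0%nat)%C).
replace (l - u 0%nat + u 0%nat)%C with l by ring. exact H.
Qed.

Lemma Cseries_at_0 (a : nat -> C) : Cseries (fun n => (a n * (RtoC 0) ^ n)%C) (a 0%nat).
Proof.
apply is_pseries_Cseries.
exact (is_pseries_0 (K := C_AbsRing) (V := C_NormedModule) a).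
Qed.

Lemma Cseries_unique (u : nat -> C) (l m : C) :
  Cseries u l -> Cseries u m -> l = m.
Proof.
intros Hl Hm.
apply (filterlim_locally_unique (K := C_AbsRing) (V := C_NormedModule)
         (F := eventually) (sum_n u) l m Hl Hm).
Qed.

Lemma analytic_at_minus (f g : C -> C) (z0 : C) :
  analytic_at f z0 -> analytic_at g z0 -> analytic_at (fun z => f z - g z)%C z0.
Proof.
intros [a [d [Hd Ha]]] [b [e [He Hb]]].
exists (fun n => a n - b n)%C, (Rmin d e). split; [apply Rmin_glb_lt; assumption|].
intros h Hh.
apply Cseries_ext with (fun n => a n * h ^ n - b n * h ^ n)%C.
- intros n; ring.
- apply Cseries_minus; [apply Ha | apply Hb]; apply Rlt_le_trans with (1 := Hh).
  apply Rmin_l. apply Rmin_r.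
Qed.

(** * Difference quotients and coefficient bounds *)

(** The diagonal value [c] is a parameter, so that it can be read off a power series before it is
    known to be the derivative. *)
Definition dq (f : C -> C) (w c z : C) : C :=
  if Ceq_dec z w then c else ((f z - f w) / (z - w))%C.

Lemma dq_diag (f : C -> C) (w c : C) : dq f w c w = c.
Proof. unfold dq. destruct (Ceq_dec w w); [reflexivity | congruence]. Qed.

Lemma dq_off (f : C -> C) (w c z : C) :
  z <> w -> dq f w c z = ((f z - f w) / (z - w))%C.
Proof. unfold dq. destruct (Ceq_dec z w); [congruence | reflexivity]. Qed.

Lemma Cminus_neq_0 (z w : C) : z <> w -> (z - w)%C <> 0%C.
Proof. intros H E. apply H. apply Ceq_minus. exact E. Qed.

Lemma dq_spec (f : C -> C) (w c z : C) : f z = (f w + (z - w) * dq f w c z)%C.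
Proof.
destruct (Ceq_dec z w) as [->|H].
- rewrite dq_diag. ring.
- rewrite dq_off by exact H. field. apply Cminus_neq_0, H.
Qed.

(** Removing the constant term and dividing by h shifts the coefficients by one; [c] is the old
    coefficient of index 1. *)
Lemma analytic_at_dq (f : C -> C) (z0 : C) :
  analytic_at f z0 -> exists c, analytic_at (dq f z0 c) z0.
Proof.
intros [a [d [Hd H]]]. exists (a 1%nat), (fun n => a (S n)), d.
split; [exact Hd|]. intros h Hh.
assert (H0 : f z0 = a 0%nat).
{ apply Cseries_unique with (fun n => (a n * (RtoC 0) ^ n)%C).
  - replace z0 with (z0 + 0)%C at 1 by ring. apply H. rewrite Cmod_0. exact Hd.
  - apply Cseries_at_0. }
destruct (Ceq_dec h 0%C) as [->|Hh0].
- replace (z0 + 0)%C with z0 by ring. rewrite dq_diag.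
  apply (Cseries_at_0 (fun n => a (S n))).
- rewrite dq_off.
  2:{ intros E. apply Hh0. replace h with (z0 + h - z0)%C by ring. rewrite E. ring. }
  assert (H1 := Cseries_scal (/ h)%C _ _ (Cseries_tail _ _ (H h Hh))).
  replace ((f (z0 + h) - f z0) / (z0 + h - z0))%C
    with (/ h * (f (z0 + h) - a 0%nat * h ^ 0))%C.
  + eapply Cseries_ext; [|exact H1]. intros n; simpl.
    change (h ^ S n)%C with (h * h ^ n)%C. field. exact Hh0.
  + rewrite H0. change (h ^ 0)%C with (RtoC 1).
    replace (z0 + h - z0)%C with h by ring. field. exact Hh0.
Qed.

(** A substitute for the Cauchy estimates: the terms of the convergent series at h = d / 2 are
    bounded. *)
Lemma analytic_at_coeff_bound (a : nat -> C) (d : R) (f : C -> C) (z0 : C) :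
  0 < d ->
  (forall h : C, Cmod h < d -> Cseries (fun n => (a n * h ^ n)%C) (f (z0 + h)%C)) ->
  exists K s, 0 < s < d /\ 0 <= K /\ forall n, Cmod (a n) * s ^ n <= K.
Proof.
intros Hd H.
assert (Hs : Cmod (d / 2)%R < d) by (rewrite Cmod_R, Rabs_pos_eq; lra).
destruct (Cseries_terms_bounded _ _ (H _ Hs)) as [K HK].
exists K, (d / 2). split; [lra|].
assert (HK' : forall n, Cmod (a n) * (d / 2) ^ n <= K).
{ intros n. specialize (HK n).
  rewrite Cmod_mult, Cmod_pow, Cmod_R, Rabs_pos_eq in HK by lra. exact HK. }
split; [|exact HK'].
assert (H0 := HK' 0%nat). simpl in H0. assert (H1 := Cmod_ge_0 (a 0%nat)). lra.
Qed.

Definition bounded_near_0 (f : C -> C) : Prop :=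
  exists K d, 0 < d /\ forall h, Cmod h < d -> Cmod (f h) <= K.

Lemma analytic_at_bounded (f : C -> C) (z0 : C) :
  analytic_at f z0 -> bounded_near_0 (fun h => f (z0 + h)%C).
Proof.
intros [a [d [Hd H]]].
destruct (analytic_at_coeff_bound a d f z0 Hd H) as [K [s [Hs [HK Ha]]]].
exists (K / (1 - / 2)), (s / 2). split; [lra|]. intros h Hh.
apply Cseries_bound with (fun n => (a n * h ^ n)%C).
- lra.
- intros n. rewrite Cmod_mult, Cmod_pow.
  apply Rle_trans with (Cmod (a n) * (s / 2) ^ n).
  + apply Rmult_le_compat_l; [apply Cmod_ge_0|]. apply pow_incr.
    split; [apply Cmod_ge_0 | lra].
  + unfold Rdiv. rewrite Rpow_mult_distr, <- Rmult_assoc.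
    apply Rmult_le_compat_r; [apply pow_le; lra | apply Ha].
- apply H. lra.
Qed.

(** * Derivatives and second-order expansions *)

Lemma C_derive_of_quadratic (f : C -> C) (z0 a1 : C) (K d : R) :
  0 < d ->
  (forall h, Cmod h < d -> Cmod (f (z0 + h) - f z0 - h * a1)%C <= K * Cmod h ^ 2) ->
  C_derive f z0 = a1.
Proof.
intros Hd H. apply is_C_derive_unique.
split; [apply is_linear_scal_l|].
intros x Hx.
assert (Ex := is_filter_lim_locally_unique (K := C_AbsRing) (V := AbsRing_NormedModule C_AbsRing) z0 x Hx).
subst x. intros eps.
(* No sign is assumed for [K]; [Rabs K + 1] is a positive divisor that dominates it. *)
assert (HK : 0 < Rabs K + 1) by (assert (H1 := Rabs_pos K); lra).
assert (Hp : 0 < Rmin d (eps / (Rabs K + 1))).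
{ apply Rmin_glb_lt; [exact Hd|]. apply Rdiv_lt_0_compat; [apply cond_pos | exact HK]. }
exists (mkposreal _ Hp). intros y Hy.
change (Cmod (y - z0) < Rmin d (eps / (Rabs K + 1))) in Hy.
change (Cmod ((f y - f z0) - (y - z0) * a1)%C <= eps * Cmod (y - z0)%C).
set (h := (y - z0)%C) in *.
replace y with (z0 + h)%C by (unfold h; ring).
apply Rle_trans with (K * Cmod h ^ 2).
- apply H. apply Rlt_le_trans with (1 := Hy), Rmin_l.
- assert (H1 : Cmod h < eps / (Rabs K + 1)) by (apply Rlt_le_trans with (1 := Hy), Rmin_r).
  assert (H2 : Cmod h * (Rabs K + 1) < eps).
  { apply Rmult_lt_compat_r with (r := Rabs K + 1) in H1; [|exact HK].
    replace (eps / (Rabs K + 1) * (Rabs K + 1)) with (pos eps) in H1 by (field; lra).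
    exact H1. }
  assert (H3 := Cmod_ge_0 h). assert (H4 := Rle_abs K). assert (H5 := Rabs_pos K).
  nra.
Qed.

(* The sharp constant is 2 instead of 4; the slack absorbs the linear factor in
   the induction step. *)
Lemma Cpow_second_difference (h k : C) (s : R) (n : nat) :
  0 < s -> Cmod h <= s -> Cmod k <= s ->
  Cmod ((h + k) ^ S n - h ^ S n - k * (INR (S n) * h ^ n))%C
    <= (Cmod k / s) ^ 2 * (4 * s) ^ S n.
Proof.
intros Hs Hh Hk.
assert (Hk0 := Cmod_ge_0 k). assert (Hh0 := Cmod_ge_0 h).
induction n as [|n IH].
- replace ((h + k) ^ 1 - h ^ 1 - k * (INR 1 * h ^ 0))%C with (RtoC 0).
  + rewrite Cmod_0. apply Rmult_le_pos; [apply pow2_ge_0 | apply pow_le; lra].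
  + simpl. ring.
(* The new remainder is h + k times the old one plus a k^2 term. Each of the two parts fits into
   half of the budget (|k| / s)^2 (4 s)^(n+2). *)
- replace ((h + k) ^ S (S n) - h ^ S (S n) - k * (INR (S (S n)) * h ^ S n))%C
    with ((h + k) * ((h + k) ^ S n - h ^ S n - k * (INR (S n) * h ^ n))
          + k * k * (INR (S n) * h ^ n))%C.
  + apply Rle_trans with (1 := Cmod_triangle _ _).
    rewrite !Cmod_mult, Cmod_pow, Cmod_R, (Rabs_pos_eq (INR (S n))) by apply pos_INR.
    set (E := Cmod ((h + k) ^ S n - h ^ S n - k * (INR (S n) * h ^ n))%C) in *.
    assert (HE : 0 <= E) by apply Cmod_ge_0.
    assert (H1 : Cmod (h + k) <= 2 * s) by (apply Rle_trans with (1 := Cmod_triangle _ _); lra).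
    assert (H1' := Cmod_ge_0 (h + k)).
    assert (H2 : Cmod (h + k) * E <= 2 * s * ((Cmod k / s) ^ 2 * (4 * s) ^ S n)).
    { apply Rmult_le_compat; assumption. }
    assert (H3 : INR (S n) <= 4 ^ S n).
    { clear. induction n as [|n IH]; [simpl; lra|]. rewrite S_INR.
      change (4 ^ S (S n)) with (4 * 4 ^ S n).
      assert (1 <= 4 ^ S n) by (apply pow_R1_Rle; lra). lra. }
    assert (H4 : Cmod h ^ n <= s ^ n) by (apply pow_incr; lra).
    assert (H5 : INR (S n) * Cmod h ^ n <= 4 ^ S n * s ^ n).
    { apply Rmult_le_compat; try assumption. apply pos_INR. apply pow_le, Hh0. }
    replace ((Cmod k / s) ^ 2 * (4 * s) ^ S (S n))
      with (2 * s * ((Cmod k / s) ^ 2 * (4 * s) ^ S n)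
            + 2 * (Cmod k * Cmod k * (4 ^ S n * s ^ n))).
    2:{ rewrite !Rpow_mult_distr. simpl. field. lra. }
    assert (H6 : 0 <= Cmod k * Cmod k) by nra.
    assert (H7 : 0 <= 4 ^ S n * s ^ n) by (apply Rmult_le_pos; apply pow_le; lra).
    assert (Cmod k * Cmod k * (INR (S n) * Cmod h ^ n) <= Cmod k * Cmod k * (4 ^ S n * s ^ n)).
    { apply Rmult_le_compat_l; assumption. }
    nra.
  + rewrite (S_INR (S n)), RtoC_plus.
    change ((h + k) ^ S (S n))%C with ((h + k) * (h + k) ^ S n)%C.
    change (h ^ S (S n))%C with (h * h ^ S n)%C.
    change (h ^ S n)%C with (h * h ^ n)%C. ring.
Qed.

(** Term-by-term differentiation: after the candidate linear part is subtracted, what remains is a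
    series of coefficients times second differences of powers, dominated by |k|^2 times a geometric
    series. [C_derive_of_quadratic] then identifies the sum of the differentiated series. *)
Lemma analytic_at_C_derive (f : C -> C) (z0 : C) :
  analytic_at f z0 -> analytic_at (C_derive f) z0.
Proof.
intros [a [d [Hd H]]].
destruct (analytic_at_coeff_bound a d f z0 Hd H) as [K [s [Hs [HK Ha]]]].
(* The factor 4 of [Cpow_second_difference] turns radius t into 4 t = s / 2, so against coefficients
   of size K / s^n the ratio is 1/2. Also |h + k| < 2 t stays below d. *)
set (t := s / 8).
assert (Ht : 0 < t) by (unfold t; lra).
exists (fun n => INR (S n) * a (S n))%C, t. split; [exact Ht|].
intros h Hh.
assert (Hcoef : forall n, Cmod (a (S n)) * (4 * t) ^ S n <= K * (/ 2) ^ S n).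
{ intros n. replace (4 * t) with (s * / 2) by (unfold t; lra).
  rewrite Rpow_mult_distr, <- Rmult_assoc. apply Rmult_le_compat_r; [apply pow_le; lra|].
  apply Ha. }
destruct (Cseries_exists (fun n => INR (S n) * a (S n) * h ^ n)%C (K / s) (/ 2)) as [L HL].
- lra.
- intros n. rewrite !Cmod_mult, Cmod_R, Cmod_pow, Rabs_pos_eq by apply pos_INR.
  assert (H1 : INR (S n) <= 4 ^ n).
  { clear. induction n as [|n IH]; [simpl; lra|]. rewrite S_INR.
    change (4 ^ S n) with (4 * 4 ^ n).
    assert (1 <= 4 ^ n) by (apply pow_R1_Rle; lra). lra. }
  assert (H2 : Cmod h ^ n <= t ^ n) by (apply pow_incr; split; [apply Cmod_ge_0 | lra]).
  assert (H3 : Cmod (a (S n)) <= K / s * (/ s) ^ n).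
  { apply Rmult_le_reg_r with (s ^ S n); [apply pow_lt; lra|].
    replace (K / s * (/ s) ^ n * s ^ S n) with K.
    - apply Ha.
    - simpl. rewrite pow_inv. field. repeat split; try (apply pow_nonzero); lra. }
  apply Rle_trans with (4 ^ n * (K / s * (/ s) ^ n) * t ^ n).
  + apply Rmult_le_compat; try assumption.
    * apply Rmult_le_pos; [apply pos_INR | apply Cmod_ge_0].
    * apply pow_le, Cmod_ge_0.
    * apply Rmult_le_compat; try assumption. apply pos_INR. apply Cmod_ge_0.
  + right. replace (/ 2) with (4 * / s * t) by (unfold t; field; lra).
    rewrite !Rpow_mult_distr. ring.
- replace (C_derive f (z0 + h)) with L; [exact HL|]. symmetry.
  apply C_derive_of_quadratic with (K := / t ^ 2 * (K / (1 - / 2))) (d := t); [exact Ht|].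
  intros k Hk.
  assert (Hhk : Cmod (h + k) < d).
  { apply Rle_lt_trans with (1 := Cmod_triangle _ _). unfold t in *; lra. }
  assert (Hh' : Cmod h < d) by (unfold t in *; lra).
  assert (S1 := Cseries_tail _ _ (H _ Hhk)).
  assert (S2 := Cseries_tail _ _ (H _ Hh')).
  assert (S3 := Cseries_minus _ _ _ _ (Cseries_minus _ _ _ _ S1 S2) (Cseries_scal k _ _ HL)).
  clear S1 S2.
  replace (f (z0 + h + k) - f (z0 + h) - k * L)%C
   with (f (z0 + (h + k)) - a 0%nat * (h + k) ^ 0 - (f (z0 + h) - a 0%nat * h ^ 0) - k * L)%C.
  2:{ replace (z0 + (h + k))%C with (z0 + h + k)%C by ring. simpl. ring. }
  replace (/ t ^ 2 * (K / (1 - / 2)) * Cmod k ^ 2)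
    with ((Cmod k / t) ^ 2 * K / (1 - / 2)) by (field; lra).
  refine (Cseries_bound _ _ ((Cmod k / t) ^ 2 * K) (/ 2) _ _ S3); [lra|].
  intros n.
  replace (a (S n) * (h + k) ^ S n - a (S n) * h ^ S n - k * (INR (S n) * a (S n) * h ^ n))%C
    with (a (S n) * ((h + k) ^ S n - h ^ S n - k * (INR (S n) * h ^ n)))%C by ring.
  rewrite Cmod_mult.
  apply Rle_trans with (Cmod (a (S n)) * ((Cmod k / t) ^ 2 * (4 * t) ^ S n)).
  + apply Rmult_le_compat_l; [apply Cmod_ge_0|].
    apply Cpow_second_difference; lra.
  + replace (Cmod (a (S n)) * ((Cmod k / t) ^ 2 * (4 * t) ^ S n))
      with ((Cmod k / t) ^ 2 * (Cmod (a (S n)) * (4 * t) ^ S n)) by ring.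
    rewrite Rmult_assoc. apply Rmult_le_compat_l; [apply pow2_ge_0|].
    apply Rle_trans with (1 := Hcoef n).
    apply Rmult_le_compat_l; [exact HK|].
    simpl. assert (0 < (/ 2) ^ n) by (apply pow_lt; lra). lra.
Qed.

(* Second-order expansions with a locally bounded cubic remainder: all that the
   maximum principle below needs to know about a holomorphic function. *)
Definition expands (f : C -> C) (z0 a0 a1 a2 : C) : Prop :=
  exists (rho : C -> C) (K d : R), 0 < d /\
    forall h, Cmod h < d ->
      Cmod (rho h) <= K /\
      f (z0 + h)%C = (a0 + a1 * h + a2 * h ^ 2 + h ^ 3 * rho h)%C.

Definition smooth_at (f : C -> C) (z0 : C) : Prop :=
  exists a0 a1 a2, expands f z0 a0 a1 a2.

Lemma expands_value (f : C -> C) (z0 a0 a1 a2 : C) :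
  expands f z0 a0 a1 a2 -> f z0 = a0.
Proof.
intros [rho [K [d [Hd H]]]].
replace z0 with (z0 + 0)%C at 1 by ring.
rewrite (proj2 (H 0%C ltac:(rewrite Cmod_0; exact Hd))). ring.
Qed.

Lemma expands_quadratic (f : C -> C) (z0 a0 a1 a2 : C) :
  expands f z0 a0 a1 a2 ->
  exists K d, 0 <= K /\ 0 < d /\ forall h, Cmod h < d ->
    Cmod (f (z0 + h) - f z0 - h * a1)%C <= K * Cmod h ^ 2.
Proof.
intros E. rewrite (expands_value _ _ _ _ _ E).
destruct E as [rho [K [d [Hd H]]]].
exists (Cmod a2 + Rabs K), (Rmin d 1).
split; [apply Rplus_le_le_0_compat; [apply Cmod_ge_0 | apply Rabs_pos]|].
split; [apply Rmin_glb_lt; lra|].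
intros h Hh.
assert (H1 : Cmod h < d) by (apply Rlt_le_trans with (1 := Hh), Rmin_l).
assert (H2 : Cmod h < 1) by (apply Rlt_le_trans with (1 := Hh), Rmin_r).
destruct (H h H1) as [Hr ->].
replace (a0 + a1 * h + a2 * h ^ 2 + h ^ 3 * rho h - a0 - h * a1)%C
  with ((a2 + h * rho h) * h ^ 2)%C by ring.
rewrite Cmod_mult, Cmod_pow. apply Rmult_le_compat_r; [apply pow2_ge_0|].
apply Rle_trans with (1 := Cmod_triangle _ _). apply Rplus_le_compat_l.
rewrite Cmod_mult. assert (H3 := Rle_abs K).
assert (H4 := Cmod_ge_0 h). assert (H5 := Cmod_ge_0 (rho h)). nra.
Qed.

Lemma expands_C_derive (f : C -> C) (z0 a0 a1 a2 : C) :
  expands f z0 a0 a1 a2 -> C_derive f z0 = a1.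
Proof.
intros E. destruct (expands_quadratic _ _ _ _ _ E) as [K [d [HK [Hd H]]]].
exact (C_derive_of_quadratic f z0 a1 K d Hd H).
Qed.

(** Three successive difference quotients at z0 peel off one coefficient each; the third one is
    again analytic, hence bounded, and serves as the cubic remainder. *)
Lemma analytic_at_smooth (f : C -> C) (z0 : C) : analytic_at f z0 -> smooth_at f z0.
Proof.
intros Hf.
destruct (analytic_at_dq _ _ Hf) as [c1 H1].
destruct (analytic_at_dq _ _ H1) as [c2 H2].
destruct (analytic_at_dq _ _ H2) as [c3 H3].
destruct (analytic_at_bounded _ _ H3) as [K [d [Hd H]]].
set (f1 := dq f z0 c1) in *. set (f2 := dq f1 z0 c2) in *. set (f3 := dq f2 z0 c3) in *.
exists (f z0), c1, c2, (fun h => f3 (z0 + h)%C), K, d.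
split; [exact Hd|]. intros h Hh. split; [apply H, Hh|].
assert (E1 := dq_spec f z0 c1 (z0 + h)). fold f1 in E1.
assert (E2 := dq_spec f1 z0 c2 (z0 + h)). fold f2 in E2.
assert (E3 := dq_spec f2 z0 c3 (z0 + h)). fold f3 in E3.
unfold f1 at 2 in E2. unfold f2 at 2 in E3. rewrite dq_diag in E2, E3.
rewrite E1, E2, E3. ring.
Qed.

Lemma bounded_near_0_plus (f g : C -> C) :
  bounded_near_0 f -> bounded_near_0 g -> bounded_near_0 (fun h => f h + g h)%C.
Proof.
intros [K [d [Hd Hf]]] [L [e [He Hg]]]. exists (K + L), (Rmin d e).
split; [apply Rmin_glb_lt; assumption|]. intros h Hh.
apply Rle_trans with (1 := Cmod_triangle _ _). apply Rplus_le_compat.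
- apply Hf, Rlt_le_trans with (1 := Hh), Rmin_l.
- apply Hg, Rlt_le_trans with (1 := Hh), Rmin_r.
Qed.

Lemma bounded_near_0_mult (f g : C -> C) :
  bounded_near_0 f -> bounded_near_0 g -> bounded_near_0 (fun h => f h * g h)%C.
Proof.
intros [K [d [Hd Hf]]] [L [e [He Hg]]]. exists (K * L), (Rmin d e).
split; [apply Rmin_glb_lt; assumption|]. intros h Hh. rewrite Cmod_mult.
apply Rmult_le_compat; try apply Cmod_ge_0.
- apply Hf, Rlt_le_trans with (1 := Hh), Rmin_l.
- apply Hg, Rlt_le_trans with (1 := Hh), Rmin_r.
Qed.

Lemma bounded_near_0_const (c : C) : bounded_near_0 (fun _ => c).
Proof. exists (Cmod c), 1. split; [lra|]. intros; apply Rle_refl. Qed.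

Lemma bounded_near_0_id : bounded_near_0 (fun h => h).
Proof. exists 1, 1. split; [lra|]. intros; lra. Qed.

(** Splits an expansion into boundedness of the remainder, which is settled by closure lemmas, and
    an algebraic identity. *)
Lemma expands_intro (f rho : C -> C) (z0 a0 a1 a2 : C) (d : R) :
  0 < d -> bounded_near_0 rho ->
  (forall h, Cmod h < d -> f (z0 + h)%C = (a0 + a1 * h + a2 * h ^ 2 + h ^ 3 * rho h)%C) ->
  expands f z0 a0 a1 a2.
Proof.
intros Hd [K [e [He HK]]] H. exists rho, K, (Rmin d e).
split; [apply Rmin_glb_lt; assumption|]. intros h Hh. split.
- apply HK, Rlt_le_trans with (1 := Hh), Rmin_r.
- apply H, Rlt_le_trans with (1 := Hh), Rmin_l.
Qed.

Lemma smooth_at_mult (f g : C -> C) (z0 : C) :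
  smooth_at f z0 -> smooth_at g z0 -> smooth_at (fun z => f z * g z)%C z0.
Proof.
intros [a0 [a1 [a2 [r [K [d [Hd Hf]]]]]]] [b0 [b1 [b2 [s [L [e [He Hg]]]]]]].
assert (Hr : bounded_near_0 r) by (exists K, d; split; [exact Hd | apply Hf]).
assert (Hs : bounded_near_0 s) by (exists L, e; split; [exact He | apply Hg]).
exists (a0 * b0)%C, (a0 * b1 + a1 * b0)%C, (a0 * b2 + a1 * b1 + a2 * b0)%C.
(* The remainder collects every term of degree at least 3 in the product, divided by h^3. *)
apply expands_intro with
  (fun h => a1 * b2 + a2 * b1 + h * (a2 * b2)
     + (a0 + a1 * h + a2 * (h * h)) * s h + (b0 + b1 * h + b2 * (h * h)) * r h
     + h * (h * h) * (r h * s h))%C (Rmin d e).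
- apply Rmin_glb_lt; assumption.
- repeat first [assumption | apply bounded_near_0_plus | apply bounded_near_0_mult
    | apply bounded_near_0_const | apply bounded_near_0_id].
- intros h Hh.
  rewrite (proj2 (Hf h ltac:(apply Rlt_le_trans with (1 := Hh), Rmin_l))).
  rewrite (proj2 (Hg h ltac:(apply Rlt_le_trans with (1 := Hh), Rmin_r))). ring.
Qed.

Lemma smooth_at_plus (f g : C -> C) (z0 : C) :
  smooth_at f z0 -> smooth_at g z0 -> smooth_at (fun z => f z + g z)%C z0.
Proof.
intros [a0 [a1 [a2 [r [K [d [Hd Hf]]]]]]] [b0 [b1 [b2 [s [L [e [He Hg]]]]]]].
assert (Hr : bounded_near_0 r) by (exists K, d; split; [exact Hd | apply Hf]).
assert (Hs : bounded_near_0 s) by (exists L, e; split; [exact He | apply Hg]).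
exists (a0 + b0)%C, (a1 + b1)%C, (a2 + b2)%C.
apply expands_intro with (fun h => r h + s h)%C (Rmin d e).
- apply Rmin_glb_lt; assumption.
- apply bounded_near_0_plus; assumption.
- intros h Hh.
  rewrite (proj2 (Hf h ltac:(apply Rlt_le_trans with (1 := Hh), Rmin_l))).
  rewrite (proj2 (Hg h ltac:(apply Rlt_le_trans with (1 := Hh), Rmin_r))). ring.
Qed.

Lemma smooth_at_const (c z0 : C) : smooth_at (fun _ => c) z0.
Proof.
exists c, 0%C, 0%C. apply expands_intro with (fun _ => RtoC 0) 1.
- lra.
- apply bounded_near_0_const.
- intros; ring.
Qed.

Lemma smooth_at_id (z0 : C) : smooth_at (fun z => z) z0.
Proof.
exists z0, 1%C, 0%C. apply expands_intro with (fun _ => RtoC 0) 1.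
- lra.
- apply bounded_near_0_const.
- intros; ring.
Qed.

Lemma smooth_at_minus (f g : C -> C) (z0 : C) :
  smooth_at f z0 -> smooth_at g z0 -> smooth_at (fun z => f z - g z)%C z0.
Proof.
intros Hf Hg.
destruct (smooth_at_plus _ _ _ Hf (smooth_at_mult _ _ _ (smooth_at_const (- (1))%C z0) Hg))
  as [a0 [a1 [a2 [r [K [d [Hd H]]]]]]].
exists a0, a1, a2, r, K, d. split; [exact Hd|]. intros h Hh.
destruct (H h Hh) as [H1 H2]. split; [exact H1|]. rewrite <- H2.
ring.
Qed.

Lemma smooth_at_ext_near (f g : C -> C) (z0 : C) (d : R) :
  0 < d -> (forall h, Cmod h < d -> f (z0 + h)%C = g (z0 + h)%C) ->
  smooth_at f z0 -> smooth_at g z0.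
Proof.
intros Hd E [a0 [a1 [a2 [r [K [e [He H]]]]]]].
exists a0, a1, a2, r, K, (Rmin d e). split; [apply Rmin_glb_lt; assumption|].
intros h Hh. rewrite <- E by (apply Rlt_le_trans with (1 := Hh), Rmin_l).
apply H, Rlt_le_trans with (1 := Hh), Rmin_r.
Qed.

Lemma smooth_at_lipschitz (f : C -> C) (z0 : C) :
  smooth_at f z0 -> exists K d, 0 <= K /\ 0 < d /\
    forall h, Cmod h < d -> Cmod (f (z0 + h) - f z0)%C <= K * Cmod h.
Proof.
intros [a0 [a1 [a2 E]]].
destruct (expands_quadratic _ _ _ _ _ E) as [K [d [HK [Hd H]]]].
exists (K + Cmod a1), (Rmin d 1).
split; [apply Rplus_le_le_0_compat; [exact HK | apply Cmod_ge_0]|].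
split; [apply Rmin_glb_lt; lra|]. intros h Hh.
assert (H1 : Cmod h < d) by (apply Rlt_le_trans with (1 := Hh), Rmin_l).
assert (H2 : Cmod h < 1) by (apply Rlt_le_trans with (1 := Hh), Rmin_r).
replace (f (z0 + h) - f z0)%C with ((f (z0 + h) - f z0 - h * a1) + h * a1)%C by ring.
apply Rle_trans with (1 := Cmod_triangle _ _). rewrite Cmod_mult.
specialize (H h H1). assert (H3 := Cmod_ge_0 h).
assert (H4 : K * Cmod h ^ 2 <= K * Cmod h).
{ apply Rmult_le_compat_l; [exact HK|]. nra. }
lra.
Qed.

Lemma smooth_at_continuous (f : C -> C) (z0 : C) (eps : R) :
  smooth_at f z0 -> 0 < eps ->
  exists d, 0 < d /\ forall h, Cmod h < d -> Cmod (f (z0 + h) - f z0)%C < eps.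
Proof.
intros Hf He. destruct (smooth_at_lipschitz f z0 Hf) as [K [d [HK [Hd H]]]].
exists (Rmin d (eps / (K + 1))). split.
- apply Rmin_glb_lt; [exact Hd|]. apply Rdiv_lt_0_compat; lra.
- intros h Hh.
  assert (H1 : Cmod h < d) by (apply Rlt_le_trans with (1 := Hh), Rmin_l).
  assert (H2 : Cmod h < eps / (K + 1)) by (apply Rlt_le_trans with (1 := Hh), Rmin_r).
  apply Rle_lt_trans with (1 := H h H1).
  apply Rmult_lt_compat_r with (r := K + 1) in H2; [|lra].
  replace (eps / (K + 1) * (K + 1)) with eps in H2 by (field; lra).
  assert (H3 := Cmod_ge_0 h). nra.
Qed.

Lemma smooth_at_neq_0_near (f : C -> C) (z0 : C) :
  smooth_at f z0 -> f z0 <> 0%C ->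
  exists m d, 0 < m /\ 0 < d /\ forall h, Cmod h < d -> m <= Cmod (f (z0 + h)%C).
Proof.
intros Hf H0. assert (Hp : 0 < Cmod (f z0)) by (apply Cmod_gt_0; exact H0).
destruct (smooth_at_continuous f z0 (Cmod (f z0) / 2) Hf ltac:(lra)) as [d [Hd H]].
exists (Cmod (f z0) / 2), d. split; [lra|]. split; [exact Hd|]. intros h Hh.
specialize (H h Hh).
assert (H1 := Cmod_triangle (f (z0 + h)%C) (- (f (z0 + h) - f z0))%C).
rewrite Cmod_opp in H1.
replace (f (z0 + h) + - (f (z0 + h) - f z0))%C with (f z0) in H1 by ring. lra.
Qed.

Lemma smooth_at_inv (f : C -> C) (z0 : C) :
  smooth_at f z0 -> f z0 <> 0%C -> smooth_at (fun z => / f z)%C z0.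
Proof.
intros Hf H0.
destruct (smooth_at_neq_0_near f z0 Hf H0) as [m [e [Hm [He Hlow]]]].
destruct Hf as [a0 [a1 [a2 E]]].
assert (Ha0 := expands_value _ _ _ _ _ E). rewrite Ha0 in H0.
destruct E as [r [K [d [Hd Hf]]]].
assert (Hr : bounded_near_0 r) by (exists K, d; split; [exact Hd | apply Hf]).
assert (Hnz : forall h, Cmod h < e -> f (z0 + h)%C <> 0%C).
{ intros h Hh E. specialize (Hlow h Hh). rewrite E, Cmod_0 in Hlow. lra. }
assert (Hinv : bounded_near_0 (fun h => / f (z0 + h))%C).
{ exists (/ m), e. split; [exact He|]. intros h Hh.
  rewrite Cmod_inv by (apply Hnz, Hh). apply Rinv_le_contravar; auto. }
(* With P = c0 + c1 h + c2 h^2 the Taylor polynomial of the reciprocal, f P = 1 + h^3 R; hence 1 / f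
   = P - h^3 R / f, and - R / f is the remainder given below. *)
pose (c0 := (/ a0)%C). pose (c1 := (- a1 / (a0 * a0))%C).
pose (c2 := ((a1 * a1 - a0 * a2) / (a0 * a0 * a0))%C).
exists c0, c1, c2.
apply expands_intro with
  (fun h => - (1) * (r h * (c0 + c1 * h + c2 * (h * h)) + a1 * c2 + a2 * c1
               + a2 * c2 * h) * / f (z0 + h))%C (Rmin d e).
- apply Rmin_glb_lt; assumption.
- repeat first [assumption | apply bounded_near_0_plus | apply bounded_near_0_mult
    | apply bounded_near_0_const | apply bounded_near_0_id].
- intros h Hh.
  assert (Hd' : Cmod h < d) by (apply Rlt_le_trans with (1 := Hh), Rmin_l).
  assert (He' : Cmod h < e) by (apply Rlt_le_trans with (1 := Hh), Rmin_r).
  specialize (Hnz h He'). rewrite (proj2 (Hf h Hd')) in Hnz |- *.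
  unfold c0, c1, c2. field. split; assumption.
Qed.

(** * The maximum modulus principle *)

(** The factor 2 is a convenient majorant of sqrt 2. It converts the coordinatewise closeness of the
    compactness theorem into closeness in modulus. *)
Lemma Cmod_lt_of_coords (z : C) (d : R) :
  Rabs (Re z) < d -> Rabs (Im z) < d -> Cmod z < 2 * d.
Proof.
intros H1 H2. apply Rle_lt_trans with (1 := Cmod_2Rmax z).
assert (H3 : Rmax (Rabs (fst z)) (Rabs (snd z)) < d) by (apply Rmax_lub_lt; assumption).
assert (H4 : 0 <= Rmax (Rabs (fst z)) (Rabs (snd z))).
{ apply Rle_trans with (1 := Rabs_pos (fst z)), Rmax_l. }
assert (H5 : 0 <= sqrt 2) by apply sqrt_pos.
assert (H6 : sqrt 2 * sqrt 2 = 2) by (apply sqrt_sqrt; lra).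
nra.
Qed.

(** [D] is bounded and has open complement, and [phi] need only be upper semicontinuous on it. If no
    maximum existed, each point would have a neighbourhood whose points of [D] are all beaten by one
    point of [D]. Finitely many neighbourhoods cover [D], and the best of the finitely many beating
    points would itself be beaten by one of them. *)
Lemma compact_max_attained (D : C -> Prop) (phi : C -> R) (b : R) (z1 : C) :
  D z1 ->
  (forall z, D z -> Cmod z <= b) ->
  (forall z, ~ D z -> exists d, 0 < d /\ forall w, Cmod (w - z) < d -> ~ D w) ->
  (forall z eps, D z -> 0 < eps ->
     exists d, 0 < d /\ forall w, D w -> Cmod (w - z) < d -> phi w < phi z + eps) ->
  exists z0, D z0 /\ forall z, D z -> phi z <= phi z0.
Proof.
intros H1 Hb Hclosed Hcont. apply NNPP. intros Hno.
(* [p] pairs half the radius of such a neighbourhood with the beating point. Around a point outside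
   [D] the neighbourhood misses [D], so the second component is arbitrary. *)
assert (Hstep : forall t : Compactness.Tn 2 R, exists p : posreal * C,
  forall w, D w -> Cmod (w - (fst t, fst (snd t)))%C < 2 * fst p ->
    D (snd p) /\ phi w < phi (snd p)).
{ intros t. set (z := (fst t, fst (snd t)) : C).
  destruct (classic (D z)) as [Hz|Hz].
  - assert (Hv : exists v, D v /\ phi z < phi v).
    { apply NNPP. intros Hn. apply Hno. exists z. split; [exact Hz|]. intros w Hw.
      apply Rnot_lt_le. intros Hlt. apply Hn. exists w. tauto. }
    destruct Hv as [v [Hv Hlt]].
    destruct (Hcont z (phi v - phi z) Hz ltac:(lra)) as [d [Hd Hw]].
    assert (Hd2 : 0 < d / 2) by lra.
    exists (mkposreal _ Hd2, v). simpl. intros w HDw Hc. split; [exact Hv|].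
    specialize (Hw w HDw ltac:(lra)). lra.
  - destruct (Hclosed z Hz) as [d [Hd Hw]].
    assert (Hd2 : 0 < d / 2) by lra.
    exists (mkposreal _ Hd2, z). simpl. intros w HDw Hc.
    exfalso. apply (Hw w); [lra | exact HDw]. }
pose (sel := fun t => proj1_sig (constructive_indefinite_description _ (Hstep t))).
assert (Hsel : forall t w, D w -> Cmod (w - (fst t, fst (snd t)))%C < 2 * fst (sel t) ->
    D (snd (sel t)) /\ phi w < phi (snd (sel t))).
{ intros t. exact (proj2_sig (constructive_indefinite_description _ (Hstep t))). }
(* The finite subcover comes under a double negation, which is harmless since the goal is
   [False]. *)
apply (compactness_list 2 (- b, (- b, tt)) (b, (b, tt)) (fun t => fst (sel t))).
intros [l Hl].
assert (Hmax : exists z0, D z0 /\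
  forall t, In t l -> D (snd (sel t)) -> phi (snd (sel t)) <= phi z0).
{ clear Hl. induction l as [|t l [z0 [H0 IH]]].
  - exists z1. split; [exact H1|]. intros t [].
  - destruct (classic (D (snd (sel t)) /\ phi z0 < phi (snd (sel t)))) as [[Ht Hlt]|Hn].
    + exists (snd (sel t)). split; [exact Ht|]. intros t' [<-|Hin] HD; [lra|].
      specialize (IH t' Hin HD). lra.
    + exists z0. split; [exact H0|]. intros t' [<-|Hin] HD; [|exact (IH t' Hin HD)].
      apply Rnot_lt_le. tauto. }
destruct Hmax as [z0 [H0 Hz0]].
assert (Hz0b : forall x, Rabs x <= Cmod z0 -> - b <= x <= b).
{ intros x Hx. specialize (Hb z0 H0). apply Rabs_le_between, Rle_trans with (1 := Hx), Hb. }
assert (HR := Rmax_Cmod z0).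
destruct (Hl (fst z0, (snd z0, tt))) as [t [Hin [_ Hclose]]].
{ simpl. split; [|split; [|exact I]]; apply Hz0b; apply Rle_trans with (2 := HR).
  apply Rmax_l. apply Rmax_r. }
destruct t as [t1 [t2 []]]. simpl in Hclose. destruct Hclose as [Hc1 [Hc2 _]].
destruct (Hsel (t1, (t2, tt)) z0 H0) as [HD Hlt].
{ simpl. apply Cmod_lt_of_coords; assumption. }
exact (Rlt_not_le _ _ Hlt (Hz0 _ Hin HD)).
Qed.

Lemma Cmod_continuity (z w : C) : Rabs (Cmod z - Cmod w) <= Cmod (z - w).
Proof.
apply Rabs_le_between. split.
- assert (H := Cmod_triangle z (- (z - w))%C). rewrite Cmod_opp in H.
  replace (z + - (z - w))%C with w in H by ring. lra.
- assert (H := Cmod_triangle w (z - w)%C).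
  replace (w + (z - w))%C with z in H by ring. lra.
Qed.

Lemma smooth_at_Cmod_continuous (g : C -> C) (z : C) (eps : R) :
  smooth_at g z -> 0 < eps ->
  exists d, 0 < d /\ forall w, Cmod (w - z) < d -> Rabs (Cmod (g w) - Cmod (g z)) < eps.
Proof.
intros Hg He. destruct (smooth_at_continuous g z eps Hg He) as [d [Hd H]].
exists d. split; [exact Hd|]. intros w Hw.
apply Rle_lt_trans with (1 := Cmod_continuity _ _).
replace w with (z + (w - z))%C at 1 by ring. apply H, Hw.
Qed.

Lemma Cmod_sqr_line (z : C) (x y : R) :
  Cmod (z + (x, y)) ^ 2 =
  Cmod z ^ 2 + 2 * (Re z * x + Im z * y) + (x ^ 2 + y ^ 2).
Proof. rewrite !Cmod2_alt. destruct z. simpl. ring. Qed.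

(* The mean of g over z0 + {t, it, -t, -it} is g z0 up to O(t^3), while that of
   |z|^2 exceeds |z0|^2 by t^2; the term eps |z|^2 thus rules out a maximum. *)
Lemma no_interior_max (g : C -> C) (z0 : C) (eps d : R) :
  smooth_at g z0 -> 0 < eps -> 0 < d ->
  exists h, Cmod h < d /\
    Cmod (g z0) + eps * Cmod z0 ^ 2 < Cmod (g (z0 + h)%C) + eps * Cmod (z0 + h) ^ 2.
Proof.
intros [a0 [a1 [a2 E]]] He Hd. rewrite (expands_value _ _ _ _ _ E).
destruct E as [rho [K [e [He' H]]]].
apply NNPP. intros Hno.
assert (Hle : forall h, Cmod h < d -> Cmod (g (z0 + h)%C) + eps * Cmod (z0 + h) ^ 2
                   <= Cmod a0 + eps * Cmod z0 ^ 2).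
{ intros h Hh. apply Rnot_lt_le. intros Hlt. apply Hno. exists h. tauto. }
clear Hno.
assert (HK : 0 <= K).
{ destruct (H 0%C) as [H0 _]; [rewrite Cmod_0; exact He'|].
  apply Rle_trans with (2 := H0), Cmod_ge_0. }
(* Small enough for the four points to lie in both neighbourhoods and for the cubic error t^3 K to
   stay below eps t^2. *)
set (t := Rmin (Rmin d e) (eps / (K + 1)) / 2).
assert (Hm : 0 < Rmin (Rmin d e) (eps / (K + 1))).
{ repeat apply Rmin_glb_lt; try assumption. apply Rdiv_lt_0_compat; lra. }
assert (Ht : 0 < t) by (unfold t; lra).
assert (Htd : t < d).
{ assert (H1 := Rmin_l (Rmin d e) (eps / (K + 1))). assert (H2 := Rmin_l d e).
  unfold t; lra. }
assert (Hte : t < e).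
{ assert (H1 := Rmin_l (Rmin d e) (eps / (K + 1))). assert (H2 := Rmin_r d e).
  unfold t; lra. }
assert (HtK : t * (K + 1) < eps).
{ assert (H1 := Rmin_r (Rmin d e) (eps / (K + 1))).
  assert (H2 : t < eps / (K + 1)) by (unfold t in *; lra).
  apply Rmult_lt_compat_r with (r := K + 1) in H2; [|lra].
  replace (eps / (K + 1) * (K + 1)) with eps in H2 by (field; lra). exact H2. }
assert (Hmod : forall x y, x ^ 2 + y ^ 2 = t ^ 2 -> Cmod (x, y) = t).
{ intros x y Hxy. unfold Cmod. simpl fst; simpl snd. rewrite Hxy.
  apply sqrt_pow2. lra. }
assert (M1 : Cmod (t, 0) = t) by (apply Hmod; ring).
assert (M2 : Cmod (0, t) = t) by (apply Hmod; ring).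
assert (M3 : Cmod (- t, 0) = t) by (apply Hmod; ring).
assert (M4 : Cmod (0, - t) = t) by (apply Hmod; ring).
assert (L1 := Hle (t, 0) ltac:(lra)). assert (L2 := Hle (0, t) ltac:(lra)).
assert (L3 := Hle (- t, 0) ltac:(lra)). assert (L4 := Hle (0, - t) ltac:(lra)).
rewrite Cmod_sqr_line in L1, L2, L3, L4.
destruct (H (t, 0) ltac:(lra)) as [B1 E1]. destruct (H (0, t) ltac:(lra)) as [B2 E2].
destruct (H (- t, 0) ltac:(lra)) as [B3 E3]. destruct (H (0, - t) ltac:(lra)) as [B4 E4].
set (g1 := g _) in L1, E1. set (g2 := g _) in L2, E2.
set (g3 := g _) in L3, E3. set (g4 := g _) in L4, E4.
set (e1 := ((t, 0) ^ 3 * rho (t, 0))%C) in *.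
set (e2 := ((0, t) ^ 3 * rho (0, t))%C) in *.
set (e3 := (((- t)%R, 0) ^ 3 * rho ((- t)%R, 0))%C) in *.
set (e4 := ((0, (- t)%R) ^ 3 * rho (0, (- t)%R))%C) in *.
(* For the increments T, iT, -T, -iT the sum and the sum of squares both vanish, so only the cubic
   remainders survive. *)
assert (Hsum : (4%R * a0)%C = (g1 + g2 + g3 + g4 + - (e1 + e2 + e3 + e4))%C).
{ rewrite E1, E2, E3, E4.
  replace ((- t, 0) : C) with (- (t, 0))%C by (unfold Copp; simpl; f_equal; ring).
  replace ((0, - t) : C) with (- (Ci * (t, 0)))%C
    by (unfold Copp, Cmult, Ci; simpl; f_equal; ring).
  replace ((0, t) : C) with (Ci * (t, 0))%C
    by (unfold Cmult, Ci; simpl; f_equal; ring).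
  set (T := (t, 0) : C).
  assert (HI : (Ci * Ci = - (1))%C) by (unfold Cmult, Ci, Copp, RtoC; simpl; f_equal; ring).
  replace ((Ci * T) ^ 2)%C with (- (T ^ 2))%C
    by (replace ((Ci * T) ^ 2)%C with (Ci * Ci * T ^ 2)%C by ring; rewrite HI; ring).
  replace ((- (Ci * T)) ^ 2)%C with (- (T ^ 2))%C
    by (replace ((- (Ci * T)) ^ 2)%C with (Ci * Ci * T ^ 2)%C by ring; rewrite HI; ring).
  ring. }
assert (Hn : forall h, Cmod h = t -> Cmod (rho h) <= K -> Cmod (h ^ 3 * rho h)%C <= t ^ 3 * K).
{ intros h Hh Hr. rewrite Cmod_mult, Cmod_pow, Hh. apply Rmult_le_compat_l; [|exact Hr].
  apply pow_le; lra. }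
assert (N1 := Hn _ M1 B1). assert (N2 := Hn _ M2 B2).
assert (N3 := Hn _ M3 B3). assert (N4 := Hn _ M4 B4).
fold e1 in N1. fold e2 in N2. fold e3 in N3. fold e4 in N4.
assert (Hfour : 4 * Cmod a0 <= Cmod g1 + Cmod g2 + Cmod g3 + Cmod g4 + 4 * (t ^ 3 * K)).
{ assert (HC : Cmod (4%R * a0) = 4 * Cmod a0).
  { rewrite Cmod_mult, Cmod_R, Rabs_pos_eq; lra. }
  rewrite <- HC, Hsum.
  assert (T0 := Cmod_triangle (g1 + g2 + g3 + g4)%C (- (e1 + e2 + e3 + e4))%C).
  assert (T1 := Cmod_triangle (g1 + g2 + g3)%C g4).
  assert (T2 := Cmod_triangle (g1 + g2)%C g3). assert (T3 := Cmod_triangle g1 g2).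
  assert (T4 := Cmod_triangle (e1 + e2 + e3)%C e4).
  assert (T5 := Cmod_triangle (e1 + e2)%C e3). assert (T6 := Cmod_triangle e1 e2).
  rewrite Cmod_opp in T0. lra. }
(* Adding [L1] to [L4] cancels the inner products with z0 and leaves 4 eps t^2 on the left; [HtK]
   contradicts the outcome. *)
assert (Hfin : eps * t ^ 2 <= t ^ 3 * K) by nra.
assert (0 < t ^ 2) by (apply pow_lt; exact Ht).
replace (t ^ 3 * K) with (t ^ 2 * (t * K)) in Hfin by ring. nra.
Qed.

(** The perturbed function |g| + eps |z|^2 attains its maximum on the closed disk, and
    [no_interior_max] pushes it to the boundary, where it is at most K + eps rho^2. *)
Lemma maximum_modulus (g : C -> C) (rho K : R) :
  0 < rho ->
  (forall z, Cmod z <= rho -> smooth_at g z) ->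
  (forall z, Cmod z = rho -> Cmod (g z) <= K) ->
  forall z, Cmod z <= rho -> Cmod (g z) <= K.
Proof.
intros Hrho Hg HK z1 Hz1. apply Rnot_lt_le. intros Hlt.
(* Makes eps rho^2 half of the supposed excess of |g z1| over [K]. *)
set (eps := (Cmod (g z1) - K) / (2 * rho ^ 2)).
assert (Hr2 : 0 < rho ^ 2) by (apply pow_lt; exact Hrho).
assert (Heps : 0 < eps) by (apply Rdiv_lt_0_compat; lra).
assert (Hepsr : eps * rho ^ 2 < Cmod (g z1) - K).
{ unfold eps. replace ((Cmod (g z1) - K) / (2 * rho ^ 2) * rho ^ 2)
    with ((Cmod (g z1) - K) / 2) by (field; lra). lra. }
destruct (compact_max_attained (fun z => Cmod z <= rho)
            (fun z => Cmod (g z) + eps * Cmod z ^ 2) rho z1) as [z0 [H0 Hmax]].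
- exact Hz1.
- tauto.
- intros z Hz. exists (Cmod z - rho). split; [lra|]. intros w Hw Hw'.
  assert (H := Cmod_continuity w z). apply Rabs_le_between in H. lra.
- intros z e Hz He.
  destruct (smooth_at_Cmod_continuous g z (e / 2) (Hg z Hz) ltac:(lra)) as [d [Hd H]].
  (* On the disk |w|^2 - |z|^2 is at most 2 rho |w - z|, so the perturbation contributes at most e /
     2, and |g| the other half. *)
  exists (Rmin d (e / (4 * (eps * rho)))).
  assert (Hp : 0 < eps * rho) by (apply Rmult_lt_0_compat; assumption).
  split; [apply Rmin_glb_lt; [exact Hd | apply Rdiv_lt_0_compat; lra]|].
  intros w Hw Hwz.
  assert (H1 := H w ltac:(apply Rlt_le_trans with (1 := Hwz), Rmin_l)).
  assert (H2 : Cmod (w - z) < e / (4 * (eps * rho)))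
    by (apply Rlt_le_trans with (1 := Hwz), Rmin_r).
  apply Rabs_def2 in H1.
  assert (H3 := Cmod_continuity w z). apply Rabs_le_between in H3.
  apply Rmult_lt_compat_r with (r := 4 * (eps * rho)) in H2; [|lra].
  replace (e / (4 * (eps * rho)) * (4 * (eps * rho))) with e in H2 by (field; lra).
  assert (H4 := Cmod_ge_0 w). assert (H5 := Cmod_ge_0 z).
  assert (H6 : Cmod w ^ 2 - Cmod z ^ 2 <= Cmod (w - z) * (2 * rho)).
  { replace (Cmod w ^ 2 - Cmod z ^ 2) with ((Cmod w - Cmod z) * (Cmod w + Cmod z)) by ring.
    assert (H7 := Cmod_ge_0 (w - z)).
    apply Rle_trans with (Cmod (w - z) * (Cmod w + Cmod z)).
    - apply Rmult_le_compat_r; lra.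
    - apply Rmult_le_compat_l; lra. }
  nra.
- assert (Hz1max := Hmax z1 Hz1). simpl in Hz1max.
  assert (Hz1sq : 0 <= eps * Cmod z1 ^ 2).
  { apply Rmult_le_pos; [lra | apply pow2_ge_0]. }
  destruct (Rle_lt_or_eq_dec _ _ H0) as [Hin|Hbd].
  + destruct (no_interior_max g z0 eps (rho - Cmod z0) (Hg z0 H0) Heps ltac:(lra))
      as [h [Hh Hbig]].
    assert (Hzh : Cmod (z0 + h) <= rho) by (assert (H := Cmod_triangle z0 h); lra).
    specialize (Hmax _ Hzh). simpl in Hmax, Hbig. lra.
  + assert (H := HK z0 Hbd). rewrite Hbd in Hz1max. lra.
Qed.

(** * Starlike functions *)

Definition slope (f : C -> C) (w : C) : C -> C := dq f w (C_derive f w).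

(** The coefficient supplied by [analytic_at_dq] is the derivative: f (w + h) - f w - h c is h times
    an increment of the quotient, hence of order h^2. *)
Lemma analytic_at_slope (f : C -> C) (w : C) :
  analytic_at f w -> analytic_at (slope f w) w.
Proof.
intros Hf. destruct (analytic_at_dq f w Hf) as [c Hc].
destruct (smooth_at_lipschitz _ _ (analytic_at_smooth _ _ Hc)) as [K [d [HK [Hd H]]]].
unfold slope. replace (C_derive f w) with c; [exact Hc|]. symmetry.
apply C_derive_of_quadratic with K d; [exact Hd|]. intros h Hh. specialize (H h Hh).
rewrite (dq_spec f w c (w + h)). rewrite dq_diag in H.
replace (f w + (w + h - w) * dq f w c (w + h) - f w - h * c)%C
  with ((dq f w c (w + h) - c) * h)%C by ring.
rewrite Cmod_mult. replace (K * Cmod h ^ 2) with (K * Cmod h * Cmod h) by ring.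
apply Rmult_le_compat_r; [apply Cmod_ge_0 | exact H].
Qed.

Lemma smooth_at_slope_off (f : C -> C) (w z : C) :
  z <> w -> smooth_at f z -> smooth_at (slope f w) z.
Proof.
intros Hz Hf.
assert (Hzw : 0 < Cmod (z - w)) by (apply Cmod_gt_0, Cminus_neq_0, Hz).
apply smooth_at_ext_near with (fun u => (f u - f w) * / (u - w))%C (Cmod (z - w)).
- exact Hzw.
- intros h Hh. unfold slope. rewrite dq_off; [reflexivity|]. intros E.
  replace h with (- (z - w))%C in Hh by (rewrite <- E; ring).
  rewrite Cmod_opp in Hh. lra.
- apply smooth_at_mult.
  + apply smooth_at_minus; [exact Hf | apply smooth_at_const].
  + apply smooth_at_inv.
    * apply smooth_at_minus; [apply smooth_at_id | apply smooth_at_const].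
    * apply Cminus_neq_0, Hz.
Qed.

(* If A'(0) = 0 then w / A(w) is unbounded as w -> 0.  But w / A(w) is the value
   at 0 of (z - w) / (A z - A w), which univalence keeps holomorphic, and which
   is bounded on |z| = 1/2 uniformly in small w. *)
Lemma univalent_C_derive_0 (A : C -> C) :
  analytic_on_disk A -> univalent_on_disk A -> A 0%C = 0%C ->
  (forall z, in_disk z -> z <> 0%C -> C_derive A z <> 0%C) ->
  C_derive A 0%C <> 0%C.
Proof.
intros Han Hinj HA0 Hd HA'0.
assert (Hsm : forall z, in_disk z -> smooth_at A z).
{ intros z Hz. apply analytic_at_smooth, analytic_on_disk_at; assumption. }
assert (Hhalf : forall z, Cmod z <= / 2 -> in_disk z).
{ intros z Hz. unfold in_disk. lra. }
assert (H0d : in_disk 0%C) by (unfold in_disk; rewrite Cmod_0; lra).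
(* Maximizing - |A| yields the minimum m of |A| on |z| = 1/2; univalence and A(0) = 0 make m
   positive. *)
destruct (compact_max_attained (fun z => Cmod z = / 2) (fun z => - Cmod (A z)) (/ 2) (/ 2)%R)
  as [z0 [Hz0 Hmin]].
- rewrite Cmod_R. apply Rabs_pos_eq. lra.
- intros; lra.
- intros z Hz. exists (Rabs (Cmod z - / 2)).
  split; [apply Rabs_pos_lt; lra|]. intros w Hw Hw'.
  assert (H := Cmod_continuity w z). rewrite Hw', Rabs_minus_sym in H. lra.
- intros z eps Hz He.
  destruct (smooth_at_Cmod_continuous A z eps (Hsm z (Hhalf z (Req_le _ _ Hz))) He)
    as [d [Hd0 H]].
  exists d. split; [exact Hd0|]. intros w _ Hw. specialize (H w Hw).
  apply Rabs_def2 in H. lra.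
- set (m := Cmod (A z0)) in *.
  assert (Hm : 0 < m).
  { apply Cmod_gt_0. intros E. rewrite <- HA0 in E.
    apply Hinj in E; [|apply Hhalf; lra | exact H0d].
    rewrite E, Cmod_0 in Hz0. lra. }
  destruct (Hsm _ H0d) as [a0 [a1 [a2 E]]].
  assert (Ea1 := expands_C_derive _ _ _ _ _ E). rewrite HA'0 in Ea1. subst a1.
  destruct (expands_quadratic _ _ _ _ _ E) as [K [d [HK [Hd0 Hq]]]].
  (* Since |A w| is at most K t^2, this choice gives |A w| < m / 2 and finally contradicts m <= 2 K
     t. *)
  set (t := Rmin (Rmin d (/ 2)) (m / (2 * (K + 1))) / 2).
  assert (Hp : 0 < Rmin (Rmin d (/ 2)) (m / (2 * (K + 1)))).
  { repeat apply Rmin_glb_lt; try lra. apply Rdiv_lt_0_compat; lra. }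
  assert (P1 := Rmin_l (Rmin d (/ 2)) (m / (2 * (K + 1)))).
  assert (P2 := Rmin_r (Rmin d (/ 2)) (m / (2 * (K + 1)))).
  assert (P3 := Rmin_l d (/ 2)). assert (P4 := Rmin_r d (/ 2)).
  assert (Ht : 0 < t) by (unfold t; lra).
  assert (Htd : t < d) by (unfold t; lra).
  assert (Ht2 : t < / 2) by (unfold t; lra).
  assert (HtK : t * (2 * (K + 1)) < m).
  { assert (H1 : t < m / (2 * (K + 1))) by (unfold t in *; lra).
    apply Rmult_lt_compat_r with (r := 2 * (K + 1)) in H1; [|lra].
    replace (m / (2 * (K + 1)) * (2 * (K + 1))) with m in H1 by (field; lra). exact H1. }
  set (w := RtoC t).
  assert (Hw : Cmod w = t) by (unfold w; rewrite Cmod_R; apply Rabs_pos_eq; lra).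
  assert (Hw0 : w <> 0%C) by (apply Cmod_gt_0; lra).
  assert (Hwd : in_disk w) by (apply Hhalf; lra).
  assert (HAw : Cmod (A w) <= K * t ^ 2).
  { specialize (Hq w ltac:(lra)). rewrite Hw in Hq.
    replace (A (0 + w) - A 0 - w * 0)%C with (A w) in Hq; [exact Hq|].
    rewrite HA0. replace (0 + w)%C with w by ring. ring. }
  assert (HAwm : Cmod (A w) < m / 2) by nra.
  assert (HAw0 : A w <> 0%C).
  { intros E0. apply Hw0. apply Hinj; [exact Hwd | exact H0d | congruence]. }
  (* On |z| = 1/2 one has |z - w| <= 1 and |A z - A w| >= m - m / 2, whence 2 / m. *)
  assert (Hbound : forall z, Cmod z <= / 2 -> Cmod (/ slope A w z) <= 2 / m).
  { apply maximum_modulus; [lra| |].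
    - intros z Hz. destruct (Ceq_dec z w) as [->|Hzw].
      + apply smooth_at_inv.
        * apply analytic_at_smooth, analytic_at_slope, analytic_on_disk_at; assumption.
        * unfold slope. rewrite dq_diag. apply Hd; assumption.
      + apply smooth_at_inv.
        * apply smooth_at_slope_off; [exact Hzw | apply Hsm, Hhalf, Hz].
        * unfold slope. rewrite dq_off by exact Hzw. intros E0.
          assert (HAA : A z <> A w).
          { intros E1. apply Hzw. apply Hinj; auto. }
          apply (Cminus_neq_0 _ _ HAA).
          replace (A z - A w)%C with ((A z - A w) / (z - w) * (z - w))%C.
          rewrite E0. ring. field. apply Cminus_neq_0, Hzw.
    - intros z Hz.
      assert (Hzw : z <> w) by (intros E0; rewrite E0 in Hz; lra).
      assert (HAA : A z <> A w).
      { intros E1. apply Hzw. apply Hinj; auto. apply Hhalf; lra. }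
      assert (Hlow : m / 2 <= Cmod (A z - A w)).
      { specialize (Hmin z Hz). simpl in Hmin.
        assert (HT := Cmod_triangle (A z - A w)%C (A w)).
        replace (A z - A w + A w)%C with (A z) in HT by ring. lra. }
      assert (Hup : Cmod (z - w) <= 1).
      { assert (HT := Cmod_triangle z (- w)%C). rewrite Cmod_opp in HT.
        unfold Cminus. lra. }
      unfold slope. rewrite dq_off by exact Hzw.
      replace (/ ((A z - A w) / (z - w)))%C with ((z - w) / (A z - A w))%C
        by (field; split; apply Cminus_neq_0; assumption).
      rewrite Cmod_div by (apply Cminus_neq_0, HAA).
      replace (2 / m) with (1 * / (m / 2)) by (field; lra).
      apply Rmult_le_compat; [apply Cmod_ge_0| |exact Hup|].
      + left. apply Rinv_0_lt_compat. lra.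
      + apply Rinv_le_contravar; lra. }
  specialize (Hbound 0%C ltac:(rewrite Cmod_0; lra)).
  unfold slope in Hbound. rewrite dq_off in Hbound by congruence.
  rewrite HA0 in Hbound.
  replace (/ ((0 - A w) / (0 - w)))%C with (w / A w)%C in Hbound.
  2:{ field. split; assumption. }
  rewrite Cmod_div, Hw in Hbound by exact HAw0.
  assert (HcA : 0 < Cmod (A w)) by (apply Cmod_gt_0; exact HAw0).
  assert (H1 : t * m <= 2 * Cmod (A w)).
  { apply Rmult_le_compat_r with (r := m * Cmod (A w)) in Hbound; [|nra].
    replace (t / Cmod (A w) * (m * Cmod (A w))) with (t * m) in Hbound by (field; lra).
    replace (2 / m * (m * Cmod (A w))) with (2 * Cmod (A w)) in Hbound by (field; lra).
    exact Hbound. }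
  assert (H2 : t * m <= t * (2 * K * t)) by nra.
  apply Rmult_le_reg_l in H2; [|exact Ht]. nra.
Qed.

(** * The Schwarz estimate for the starlike quotient *)

Lemma starlike_neq_0 (A : C -> C) (z : C) :
  starlike_analytic A -> in_disk z -> z <> 0%C -> A z <> 0%C.
Proof.
intros [_ [Hinj [HA0 _]]] Hz Hz0 E. apply Hz0. apply Hinj.
- exact Hz.
- unfold in_disk. rewrite Cmod_0. lra.
- congruence.
Qed.

Lemma starlike_C_derive_neq_0 (A : C -> C) (z : C) :
  starlike_analytic A -> in_disk z -> C_derive A z <> 0%C.
Proof.
intros [Han [Hinj [HA0 [Hre _]]]] Hz.
assert (Hoff : forall z, in_disk z -> z <> 0%C -> C_derive A z <> 0%C).
{ intros u Hu Hu0 E. specialize (Hre u Hu Hu0). unfold starlike_quotient in Hre.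
  rewrite E in Hre. replace (u * 0 / A u)%C with (RtoC 0) in Hre; [simpl in Hre; lra|].
  unfold Cdiv. ring. }
destruct (Ceq_dec z 0%C) as [->|Hz0].
- apply univalent_C_derive_0; assumption.
- apply Hoff; assumption.
Qed.

(** The Cayley transform sends the right half-plane into the unit disk: |p + 1|^2 - |p - 1|^2 = 4 Re
    p. *)
Lemma Cmod_minus_1_le_plus_1 (p : C) : 0 < Re p -> Cmod (p - 1) <= Cmod (p + 1) /\ (p + 1)%C <> 0%C.
Proof.
intros Hp. split.
- apply Rsqr_incr_0_var; [|apply Cmod_ge_0]. unfold Rsqr.
  replace (Cmod (p - 1) * Cmod (p - 1)) with (Cmod (p - 1) ^ 2) by ring.
  replace (Cmod (p + 1) * Cmod (p + 1)) with (Cmod (p + 1) ^ 2) by ring.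
  rewrite !Cmod2_alt. destruct p as [x y]. simpl in *. nra.
- intros E. apply (f_equal Re) in E. destruct p as [x y]. simpl in *. lra.
Qed.

(* Schwarz lemma for (p - 1) / (p + 1), where p = z A' / A: dividing by z it
   becomes slope (A' - B) 0 / (A' + B) with B = A / z. *)
Lemma starlike_schwarz (A : C -> C) (z : C) :
  starlike_analytic A -> in_disk z -> z <> 0%C ->
  Cmod (starlike_quotient A z - 1) <= Cmod z * Cmod (starlike_quotient A z + 1).
Proof.
intros HA Hz Hz0. assert (HA' := HA). destruct HA' as [Han [Hinj [HA0 [Hre _]]]].
assert (H0d : in_disk 0%C) by (unfold in_disk; rewrite Cmod_0; lra).
assert (Hat : forall u : C, in_disk u -> analytic_at A u)
  by (intros u Hu; apply analytic_on_disk_at; assumption).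
set (B := slope A 0%C).
(* Off 0 these are A(u) / u times p - 1 and p + 1, but they make sense at 0 as well: [D] vanishes
   there and [T] equals 2 A'(0), which is nonzero. *)
set (D := fun u => (C_derive A u - B u)%C).
set (T := fun u => (C_derive A u + B u)%C).
set (g := fun u => (slope D 0%C u * / T u)%C).
assert (HB : forall u : C, u <> 0%C -> B u = (A u / u)%C).
{ intros u Hu. unfold B, slope. rewrite dq_off by exact Hu. rewrite HA0.
  field. exact Hu. }
assert (HB0 : B 0%C = C_derive A 0%C) by apply dq_diag.
assert (HD0 : D 0%C = 0%C) by (unfold D; rewrite HB0; ring).
assert (HD : forall u : C, in_disk u -> u <> 0%C ->
   D u = (A u / u * (starlike_quotient A u - 1))%C).
{ intros u Hu Hu0. unfold D. rewrite HB by exact Hu0. unfold starlike_quotient.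
  field. split; [apply (starlike_neq_0 A); assumption | exact Hu0]. }
assert (HT : forall u : C, in_disk u -> u <> 0%C ->
   T u = (A u / u * (starlike_quotient A u + 1))%C).
{ intros u Hu Hu0. unfold T. rewrite HB by exact Hu0. unfold starlike_quotient.
  field. split; [apply (starlike_neq_0 A); assumption | exact Hu0]. }
assert (HAu : forall u : C, in_disk u -> u <> 0%C -> (A u / u)%C <> 0%C).
{ intros u Hu Hu0 E. apply (starlike_neq_0 A u HA Hu Hu0).
  replace (A u) with (A u / u * u)%C by (field; exact Hu0). rewrite E. ring. }
assert (HTnz : forall u : C, in_disk u -> T u <> 0%C).
{ intros u Hu. destruct (Ceq_dec u 0%C) as [->|Hu0].
  - unfold T. rewrite HB0. intros E.
    apply (starlike_C_derive_neq_0 A 0%C HA H0d).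
    replace (C_derive A 0%C) with (/ 2%R * (C_derive A 0%C + C_derive A 0%C))%C.
    + rewrite E. ring.
    + field.
  - rewrite HT by assumption. apply Cmult_neq_0; [apply HAu; assumption|].
    apply (Cmod_minus_1_le_plus_1 _ (Hre u Hu Hu0)). }
assert (Hg : forall u : C, in_disk u -> u <> 0%C ->
   (u * g u * (starlike_quotient A u + 1) = starlike_quotient A u - 1)%C).
{ intros u Hu Hu0. unfold g, slope. rewrite dq_off by exact Hu0.
  rewrite HD0, HD, HT by assumption.
  assert (N1 := HAu u Hu Hu0).
  assert (N2 := proj2 (Cmod_minus_1_le_plus_1 _ (Hre u Hu Hu0))).
  set (q := (A u / u)%C) in *. set (p := starlike_quotient A u) in *.
  field. repeat split; assumption. }
assert (Hsm : forall u : C, in_disk u -> smooth_at g u).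
{ intros u Hu. destruct (Ceq_dec u 0%C) as [->|Hu0].
  - assert (HBan : analytic_at B 0%C) by (apply analytic_at_slope, Hat, H0d).
    assert (HA'an : analytic_at (C_derive A) 0%C) by (apply analytic_at_C_derive, Hat, H0d).
    apply smooth_at_mult.
    + apply analytic_at_smooth, analytic_at_slope, analytic_at_minus; assumption.
    + apply smooth_at_inv; [|apply HTnz, H0d].
      apply smooth_at_plus; apply analytic_at_smooth; assumption.
  - assert (HBsm : smooth_at B u)
      by (apply smooth_at_slope_off, analytic_at_smooth, Hat; assumption).
    assert (HA'sm : smooth_at (C_derive A) u)
      by (apply analytic_at_smooth, analytic_at_C_derive, Hat, Hu).
    apply smooth_at_mult.
    + apply smooth_at_slope_off; [exact Hu0|]. apply smooth_at_minus; assumption.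
    + apply smooth_at_inv; [|apply HTnz, Hu]. apply smooth_at_plus; assumption. }
(* On |u| = rho the inequality |u g| <= 1 gives |g| <= 1 / rho, which the maximum principle carries
   inward to z. *)
assert (Hrho : forall rho, Cmod z <= rho < 1 -> Cmod (g z) * rho <= 1).
{ intros rho Hrho. assert (Hzp : 0 < Cmod z) by (apply Cmod_gt_0; exact Hz0).
  apply Rmult_le_reg_r with (/ rho); [apply Rinv_0_lt_compat; lra|].
  replace (Cmod (g z) * rho * / rho) with (Cmod (g z)) by (field; lra).
  apply maximum_modulus with rho; [lra| | |lra].
  - intros u Hu. apply Hsm. unfold in_disk. lra.
  - intros u Hu. assert (Hud : in_disk u) by (unfold in_disk; lra).
    assert (Hu0 : u <> 0%C) by (apply Cmod_gt_0; lra).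
    assert (Hgu := f_equal Cmod (Hg u Hud Hu0)). rewrite !Cmod_mult in Hgu.
    destruct (Cmod_minus_1_le_plus_1 _ (Hre u Hud Hu0)) as [Hle Hnz].
    rewrite <- Hgu, Hu in Hle. apply Cmod_gt_0 in Hnz.
    apply Rmult_le_reg_l with rho; [lra|].
    replace (rho * (1 * / rho)) with 1 by (field; lra).
    apply Rmult_le_reg_r with (1 := Hnz). lra. }
(* The limit rho -> 1: were |g z| > 1, a rho strictly between 1 / |g z| and 1 and not below |z|
   would violate [Hrho]. *)
assert (Hg1 : Cmod (g z) <= 1).
{ unfold in_disk in Hz. assert (Hgz := Cmod_ge_0 (g z)). apply Rnot_lt_le. intros Hlt.
  assert (Hi : / Cmod (g z) < 1) by (rewrite <- Rinv_1; apply Rinv_lt_contravar; lra).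
  set (rho := (Rmax (Cmod z) (/ Cmod (g z)) + 1) / 2).
  assert (Hmx : Rmax (Cmod z) (/ Cmod (g z)) < 1) by (apply Rmax_lub_lt; assumption).
  assert (M1 := Rmax_l (Cmod z) (/ Cmod (g z))).
  assert (M2 := Rmax_r (Cmod z) (/ Cmod (g z))).
  assert (H1 := Hrho rho ltac:(unfold rho; lra)).
  assert (H2 : / Cmod (g z) < rho) by (unfold rho; lra).
  apply Rmult_lt_compat_l with (r := Cmod (g z)) in H2; [|lra].
  rewrite Rinv_r in H2; lra. }
assert (Hgz := f_equal Cmod (Hg z Hz Hz0)). rewrite !Cmod_mult in Hgz.
rewrite <- Hgz. apply Rmult_le_compat_r; [apply Cmod_ge_0|].
assert (Hcz := Cmod_ge_0 z). nra.
Qed.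

(** Solve |p - 1| <= |z| |p + 1| <= |z| (|p - 1| + 2) for |p - 1|. *)
Lemma starlike_quotient_bound (A : C -> C) (z : C) :
  starlike_analytic A -> in_disk z -> z <> 0%C ->
  Cmod (starlike_quotient A z - 1) <= 2 * Cmod z / (1 - Cmod z).
Proof.
intros HA Hz Hz0. assert (H := starlike_schwarz A z HA Hz Hz0).
unfold in_disk in Hz. set (p := starlike_quotient A z) in *.
assert (HT := Cmod_triangle (p - 1)%C (2%R : C)).
replace (p - 1 + 2%R)%C with (p + 1)%C in HT
  by (replace (RtoC 2) with (1 + 1)%C by (rewrite <- RtoC_plus; f_equal; lra); ring).
rewrite Cmod_R, (Rabs_pos_eq 2) in HT by lra.
apply Rmult_le_reg_r with (1 - Cmod z); [lra|].
replace (2 * Cmod z / (1 - Cmod z) * (1 - Cmod z)) with (2 * Cmod z) by (field; lra).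
assert (Hcz := Cmod_ge_0 z). nra.
Qed.

(** * Differentiation along the circle *)

(** Stated by coordinates, to match the real derivatives inside [curve_length]. *)
Definition is_Cderive (gamma : R -> C) (t : R) (l : C) : Prop :=
  is_derive (fun s => Re (gamma s)) t (Re l) /\
  is_derive (fun s => Im (gamma s)) t (Im l).

Lemma is_Cderive_ext (f g : R -> C) (t : R) (l : C) :
  (forall s, f s = g s) -> is_Cderive f t l -> is_Cderive g t l.
Proof.
intros E [H1 H2].
split; (eapply is_derive_ext; [|eassumption]); intros s; simpl; now rewrite E.
Qed.

Lemma is_Cderive_const (c : C) (t : R) : is_Cderive (fun _ => c) t 0%C.
Proof.
split; apply (is_derive_const (K := R_AbsRing) (V := R_NormedModule)).
Qed.

Lemma is_Cderive_plus (f g : R -> C) (t : R) (l m : C) :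
  is_Cderive f t l -> is_Cderive g t m -> is_Cderive (fun s => f s + g s)%C t (l + m)%C.
Proof.
intros [Hf1 Hf2] [Hg1 Hg2].
split; apply (is_derive_plus (K := R_AbsRing) (V := R_NormedModule)); assumption.
Qed.

Lemma is_Cderive_mult (f g : R -> C) (t : R) (l m : C) :
  is_Cderive f t l -> is_Cderive g t m ->
  is_Cderive (fun s => f s * g s)%C t (l * g t + f t * m)%C.
Proof.
intros [Hf1 Hf2] [Hg1 Hg2]. split.
- replace (Re (l * g t + f t * m)%C) with
    ((Re l * Re (g t) + Re (f t) * Re m) - (Im l * Im (g t) + Im (f t) * Im m))
    by (unfold Re, Im; simpl; ring).
  apply (is_derive_minus (K := R_AbsRing) (V := R_NormedModule));
    apply Derive.is_derive_mult; assumption.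
- replace (Im (l * g t + f t * m)%C) with
    ((Re l * Im (g t) + Re (f t) * Im m) + (Im l * Re (g t) + Im (f t) * Re m))
    by (unfold Re, Im; simpl; ring).
  apply (is_derive_plus (K := R_AbsRing) (V := R_NormedModule));
    apply Derive.is_derive_mult; assumption.
Qed.

Lemma is_derive_lipschitz (f : R -> R) (t l : R) :
  is_derive f t l -> exists d, 0 < d /\
    forall u, Rabs u < d -> Rabs (f (t + u) - f t) <= (Rabs l + 1) * Rabs u.
Proof.
intros H. apply is_derive_Reals in H. destruct (H 1 Rlt_0_1) as [d Hd].
exists d. split; [apply cond_pos|]. intros u Hu.
destruct (Req_dec u 0) as [->|Hu0].
- rewrite Rplus_0_r, Rminus_diag, Rabs_R0. lra.
- specialize (Hd u Hu0 Hu).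
  replace (f (t + u) - f t) with (((f (t + u) - f t) / u - l + l) * u) by (field; exact Hu0).
  rewrite Rabs_mult. apply Rmult_le_compat_r; [apply Rabs_pos|].
  apply Rle_trans with (1 := Rabs_triang _ _). lra.
Qed.

Lemma is_derive_quadratic_0 (e : R -> R) (t K d : R) :
  0 < d -> (forall u, Rabs u < d -> Rabs (e (t + u)) <= K * u ^ 2) ->
  is_derive e t 0.
Proof.
intros Hd H. apply is_derive_Reals. intros eps He.
assert (HK : 0 < Rabs K + 1) by (assert (H1 := Rabs_pos K); lra).
assert (Hp : 0 < Rmin d (eps / (Rabs K + 1))).
{ apply Rmin_glb_lt; [exact Hd|]. apply Rdiv_lt_0_compat; lra. }
assert (He0 : e t = 0).
{ specialize (H 0 ltac:(rewrite Rabs_R0; exact Hd)). rewrite Rplus_0_r in H.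
  assert (H1 := Rabs_pos (e t)). apply Rabs_eq_0. lra. }
exists (mkposreal _ Hp). simpl. intros u Hu0 Hu.
specialize (H u (Rlt_le_trans _ _ _ Hu (Rmin_l _ _))).
assert (H2 : Rabs u < eps / (Rabs K + 1)) by (apply Rlt_le_trans with (1 := Hu), Rmin_r).
rewrite He0. replace ((e (t + u) - 0) / u - 0) with (e (t + u) * / u) by (field; exact Hu0).
assert (Hu1 := Rabs_pos_lt u Hu0).
rewrite Rabs_mult, Rabs_inv.
apply Rmult_lt_compat_r with (r := Rabs K + 1) in H2; [|exact HK].
replace (eps / (Rabs K + 1) * (Rabs K + 1)) with eps in H2 by (field; lra).
apply Rmult_lt_reg_r with (Rabs u); [exact Hu1|].
replace (Rabs (e (t + u)) * / Rabs u * Rabs u) with (Rabs (e (t + u))) by (field; lra).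
replace (u ^ 2) with (Rabs u * Rabs u) in H by (rewrite <- Rabs_mult, Rabs_pos_eq; [ring | nra]).
assert (H3 := Rle_abs K).
assert (K * (Rabs u * Rabs u) <= Rabs K * (Rabs u * Rabs u)).
{ apply Rmult_le_compat_r; [nra | exact H3]. }
assert (Rabs K * (Rabs u * Rabs u) < eps * Rabs u).
{ rewrite <- Rmult_assoc. apply Rmult_lt_compat_r; [exact Hu1|]. nra. }
lra.
Qed.

Lemma im_le_Cmod (z : C) : Rabs (Im z) <= Cmod z.
Proof. apply Rle_trans with (2 := Rmax_Cmod z), Rmax_r. Qed.

Lemma Cmod_le_coords (z : C) : Cmod z <= Rabs (Re z) + Rabs (Im z).
Proof.
replace z with (Re z + Ci * Im z)%C at 1.
- apply Rle_trans with (1 := Cmod_triangle _ _).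
  rewrite Cmod_mult, Cmod_Ci, !Cmod_R. lra.
- destruct z as [x y]. unfold Cplus, Cmult, Ci, RtoC. simpl. f_equal; ring.
Qed.

(** Chain rule: f along gamma equals its value at t plus a1 times the increment of gamma plus an
    error. As that increment is locally Lipschitz, the error is quadratic in the parameter and has
    derivative 0. *)
Lemma is_Cderive_comp (f : C -> C) (gamma : R -> C) (t : R) (l : C) :
  smooth_at f (gamma t) -> is_Cderive gamma t l ->
  is_Cderive (fun s => f (gamma s)) t (C_derive f (gamma t) * l)%C.
Proof.
intros [a0 [a1 [a2 E]]] Hg.
rewrite (expands_C_derive _ _ _ _ _ E).
destruct (expands_quadratic _ _ _ _ _ E) as [K [d [HK [Hd H]]]].
assert (Hg' := Hg). destruct Hg' as [Hre Him].
destruct (is_derive_lipschitz _ _ _ Hre) as [d1 [Hd1 H1]].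
destruct (is_derive_lipschitz _ _ _ Him) as [d2 [Hd2 H2]].
set (L := Rabs (Re l) + 1 + (Rabs (Im l) + 1)).
assert (HL : 0 < L) by (assert (P1 := Rabs_pos (Re l)); assert (P2 := Rabs_pos (Im l)); unfold L; lra).
set (h := fun s => (gamma s - gamma t)%C).
assert (Hh : forall u, Rabs u < Rmin d1 d2 -> Cmod (h (t + u)) <= L * Rabs u).
{ intros u Hu.
  specialize (H1 u (Rlt_le_trans _ _ _ Hu (Rmin_l _ _))).
  specialize (H2 u (Rlt_le_trans _ _ _ Hu (Rmin_r _ _))).
  assert (P := Cmod_le_coords (h (t + u))).
  change (Re (h (t + u))) with (Re (gamma (t + u)) - Re (gamma t)) in P.
  change (Im (h (t + u))) with (Im (gamma (t + u)) - Im (gamma t)) in P.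
  unfold L. lra. }
set (e := fun s => (f (gamma t + h s) - f (gamma t) - h s * a1)%C).
assert (He : exists d', 0 < d' /\ forall u, Rabs u < d' -> Cmod (e (t + u)) <= K * L ^ 2 * u ^ 2).
{ exists (Rmin (Rmin d1 d2) (d / L)). split.
  - repeat apply Rmin_glb_lt; try assumption. apply Rdiv_lt_0_compat; assumption.
  - intros u Hu. specialize (Hh u (Rlt_le_trans _ _ _ Hu (Rmin_l _ _))).
    assert (Hud := Rlt_le_trans _ _ _ Hu (Rmin_r (Rmin d1 d2) (d / L))).
    apply Rmult_lt_compat_l with (r := L) in Hud; [|exact HL].
    replace (L * (d / L)) with d in Hud by (field; lra).
    apply Rle_trans with (1 := H (h (t + u)) (Rle_lt_trans _ _ _ Hh Hud)).
    rewrite Rmult_assoc. apply Rmult_le_compat_l; [exact HK|].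
    replace (L ^ 2 * u ^ 2) with ((L * Rabs u) ^ 2)
      by (rewrite Rpow_mult_distr, pow2_abs; reflexivity).
    apply pow_incr. split; [apply Cmod_ge_0 | exact Hh]. }
destruct He as [d' [Hd' He]].
assert (Hde : is_Cderive e t 0%C).
{ split; apply is_derive_quadratic_0 with (K * L ^ 2) d'; try exact Hd';
    intros u Hu; apply Rle_trans with (2 := He u Hu); [apply (re_le_Cmod (e (t + u))) | apply (im_le_Cmod (e (t + u)))]. }
assert (Hdh : is_Cderive h t l).
{ apply is_Cderive_ext with (fun s => gamma s + - gamma t)%C; [reflexivity|].
  replace l with (l + 0)%C by ring. apply is_Cderive_plus; [exact Hg | apply is_Cderive_const]. }
apply is_Cderive_ext with (fun s => f (gamma t) + (a1 * h s + e s))%C.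
- intros s. unfold e. replace (gamma t + h s)%C with (gamma s) by (unfold h; ring). ring.
- replace (a1 * l)%C with (0 + (0 * h t + a1 * l + 0))%C by ring.
  apply is_Cderive_plus; [apply is_Cderive_const|].
  apply is_Cderive_plus; [|exact Hde].
  apply (is_Cderive_mult (fun _ => a1) h t 0%C l); [apply is_Cderive_const | exact Hdh].
Qed.

(** A constant logarithmic derivative c is multiplied by n in the n-th power. On the circle the
    conjugate of z has c = - i. *)
Lemma is_Cderive_Cpow (gamma : R -> C) (t : R) (c : C) (n : nat) :
  is_Cderive gamma t (c * gamma t)%C ->
  is_Cderive (fun s => gamma s ^ n)%C t (INR n * c * gamma t ^ n)%C.
Proof.
intros H. induction n as [|n IH].
- simpl. replace (0 * c * 1)%C with (RtoC 0) by ring. apply is_Cderive_const.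
- replace (INR (S n) * c * gamma t ^ S n)%C
    with (c * gamma t * gamma t ^ n + gamma t * (INR n * c * gamma t ^ n))%C.
  + apply is_Cderive_mult; assumption.
  + rewrite S_INR, RtoC_plus. change (gamma t ^ S n)%C with (gamma t * gamma t ^ n)%C. ring.
Qed.

Lemma is_Cderive_sum (u du : nat -> R -> C) (t : R) (n : nat) :
  (forall k, (1 <= k <= n)%nat -> is_Cderive (u k) t (du k t)) ->
  is_Cderive (fun s => sum_n_m (fun k => u k s) 1 n) t (sum_n_m (fun k => du k t) 1 n).
Proof.
induction n as [|n IH]; intros H.
- apply is_Cderive_ext with (fun _ => RtoC 0).
  + intros s. rewrite sum_n_m_zero by lia. reflexivity.
  + rewrite sum_n_m_zero by lia. apply is_Cderive_const.
- apply is_Cderive_ext with (fun s => sum_n_m (fun k => u k s) 1 n + u (S n) s)%C.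
  + intros s. rewrite sum_n_Sm by lia. reflexivity.
  + rewrite sum_n_Sm by lia. apply is_Cderive_plus; [|apply H; lia].
    apply IH. intros k Hk. apply H. lia.
Qed.

(** Applied to the velocity of the curve, it gives the continuity of the speed. *)
Lemma is_Cderive_continuous_Cmod (gamma : R -> C) (t : R) (l : C) :
  is_Cderive gamma t l -> continuous (fun s => Cmod (gamma s)) t.
Proof.
intros [H1 H2].
assert (C1 := ex_derive_continuous _ _ (ex_intro _ _ H1)).
assert (C2 := ex_derive_continuous _ _ (ex_intro _ _ H2)).
unfold Cmod. apply (continuous_comp (fun s => fst (gamma s) ^ 2 + snd (gamma s) ^ 2) sqrt).
- apply (continuous_plus (K := R_AbsRing) (V := R_NormedModule)); simpl;
    repeat apply (continuous_mult (K := R_AbsRing));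
    try assumption; apply continuous_const.
- apply continuous_sqrt.
Qed.

Lemma is_Cderive_circle (r t : R) :
  is_Cderive (fun s => (r * cos s, r * sin s)) t (Ci * (r * cos t, r * sin t)%R)%C.
Proof.
split; simpl.
- replace (0 * (r * cos t) - 1 * (r * sin t)) with (- (r * sin t)) by ring. auto_derive; [exact I | ring].
- replace (0 * (r * sin t) + 1 * (r * cos t)) with (r * cos t) by ring. auto_derive; [exact I | ring].
Qed.

Lemma is_Cderive_Cconj (gamma : R -> C) (t : R) (l : C) :
  is_Cderive gamma t l -> is_Cderive (fun s => Cconj (gamma s)) t (Cconj l).
Proof.
intros [H1 H2]. split; [exact H1|]. simpl.
apply (is_derive_opp (K := R_AbsRing) (V := R_NormedModule)), H2.
Qed.

(** * From the termwise bound to the arclength *)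

(** The right-hand side is the exact value of the summed weights, so both the base case and the
    increment are field identities; [S n] stands for alpha. *)
Lemma Cmod_sum_weights (u : nat -> C) (M r : R) (n : nat) :
  0 < r < 1 ->
  (forall k, (1 <= k <= n)%nat ->
     Cmod (u k) <= r ^ k * (M * (INR k * ((1 + r) / (1 - r)) - 1))) ->
  Cmod (sum_n_m u 1 n) <=
    M * r / (1 - r) *
    ((1 + r) * (INR n * r ^ S n - INR (S n) * r ^ n + 1) / (1 - r) ^ 2 - 1 + r ^ n).
Proof.
intros Hr. induction n as [|n IH]; intros H.
- rewrite sum_n_m_zero by lia. change (Cmod 0%C <= M * r / (1 - r) *
    ((1 + r) * (INR 0 * r ^ 1 - INR 1 * r ^ 0 + 1) / (1 - r) ^ 2 - 1 + r ^ 0)).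
  rewrite Cmod_0. right. simpl. field. lra.
- rewrite sum_n_Sm by lia. apply Rle_trans with (1 := Cmod_triangle _ _).
  assert (H1 := IH ltac:(intros k Hk; apply H; lia)).
  assert (H2 := H (S n) ltac:(lia)).
  apply Rle_trans with (1 := Rplus_le_compat _ _ _ _ H1 H2). right.
  rewrite !S_INR. simpl. field. lra.
Qed.

Lemma starlike_term_bound (A : C -> C) (k : nat) (z : C) (r M : R) :
  starlike_analytic A -> (1 <= k)%nat -> 0 < r < 1 -> Cmod z = r -> Cmod (A z) <= M ->
  Cmod (INR k * - Ci * Cconj z ^ k * A z + Cconj z ^ k * (C_derive A z * (Ci * z)))%C
    <= r ^ k * (M * (INR k * ((1 + r) / (1 - r)) - 1)).
Proof.
intros HA Hk Hr Hz HM.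
assert (Hzd : in_disk z) by (unfold in_disk; lra).
assert (Hz0 : z <> 0%C) by (apply Cmod_gt_0; lra).
assert (HAz := starlike_neq_0 A z HA Hzd Hz0).
assert (Hp := starlike_quotient_bound A z HA Hzd Hz0). rewrite Hz in Hp.
replace (INR k * - Ci * Cconj z ^ k * A z + Cconj z ^ k * (C_derive A z * (Ci * z)))%C
  with (Ci * Cconj z ^ k * (A z * (starlike_quotient A z - INR k)))%C
  by (unfold starlike_quotient; field; exact HAz).
rewrite !Cmod_mult, Cmod_Ci, Cmod_pow, Cmod_conj, Hz, Rmult_1_l.
apply Rmult_le_compat_l; [apply pow_le; lra|].
apply Rmult_le_compat; try apply Cmod_ge_0; [exact HM|].
assert (Hk1 : 1 <= INR k) by (apply (le_INR 1); exact Hk).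
assert (HT := Cmod_triangle (starlike_quotient A z - 1)%C (1 - INR k)%C).
replace (starlike_quotient A z - 1 + (1 - INR k))%C with (starlike_quotient A z - INR k)%C in HT by ring.
rewrite <- RtoC_minus, Cmod_R, Rabs_minus_sym, (Rabs_pos_eq (INR k - 1)) in HT by lra.
apply Rle_trans with (1 := HT).
assert (Hq : 0 <= 2 * r / (1 - r)) by (apply Rdiv_le_0_compat; lra).
replace ((1 + r) / (1 - r)) with (1 + 2 * r / (1 - r)) by (field; lra).
(* Here |p - k| <= 2r / (1 - r) + (k - 1), and the first summand is enlarged by the factor k >= 1 to
   reach the stated weight. *)
nra.
Qed.

Theorem theorem4 :
  forall (alpha : nat) (A : nat -> C -> C) (F : C -> C) (r : R) (M : R -> R),
    (2 <= alpha)%nat ->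
    (forall z : C, in_disk z -> F z = polyanalytic_sum (alpha - 1) A z) ->
    (forall k : nat, (1 <= k <= alpha - 1)%nat -> starlike_analytic (A k)) ->
    0 < r < 1 ->
    (forall (k : nat) (z : C), (1 <= k <= alpha - 1)%nat -> Cmod z = r ->
       Cmod (A k z) <= M r) ->
    arclength F r <=
      2 * PI * M r * r / (1 - r) *
      ((1 + r) * ((INR alpha - 1) * r ^ alpha - INR alpha * r ^ (alpha - 1) + 1)
         / (1 - r) ^ 2
       - 1 + r ^ (alpha - 1)).
Proof.
intros alpha A F r M Halpha HF HA Hr HM.
destruct alpha as [|n]; [lia|].
replace (S n - 1)%nat with n in * by lia.
set (c := fun t => (r * cos t, r * sin t) : C).
assert (Hc : forall t, Cmod (c t) = r).
{ intros t. rewrite <- (sqrt_pow2 r) at 1 by lra. unfold Cmod, c. f_equal. simpl.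
  assert (H := sin2_cos2 t). unfold Rsqr in H.
  replace (r * cos t * (r * cos t * 1) + r * sin t * (r * sin t * 1))
    with (r * r * (sin t * sin t + cos t * cos t)) by ring. rewrite H. ring. }
assert (Hcd : forall t, in_disk (c t)) by (intros t; unfold in_disk; rewrite Hc; lra).
assert (Hdc : forall t, is_Cderive c t (Ci * c t)%C) by (intros t; apply is_Cderive_circle).
assert (Hpow : forall k t, is_Cderive (fun s => Cconj (c s) ^ k)%C t
                 (INR k * - Ci * Cconj (c t) ^ k)%C).
{ intros k t. apply (is_Cderive_Cpow (fun s => Cconj (c s))).
  replace (- Ci * Cconj (c t))%C with (Cconj (Ci * c t)).
  - apply is_Cderive_Cconj, Hdc.
  - rewrite Cmult_conj. f_equal. unfold Cconj, Copp, Ci. simpl. f_equal; ring. }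
assert (Han : forall k t, (1 <= k <= n)%nat -> analytic_at (A k) (c t)).
{ intros k t Hk. apply analytic_on_disk_at; [apply (HA k Hk) | apply Hcd]. }
set (du := fun k t => (INR k * - Ci * Cconj (c t) ^ k * A k (c t)
                       + Cconj (c t) ^ k * (C_derive (A k) (c t) * (Ci * c t)))%C).
set (dg := fun t => sum_n_m (fun k => du k t) 1 n).
assert (Hgamma : forall t, is_Cderive (circle_image F r) t (dg t)).
{ intros t.
  apply is_Cderive_ext with
    (fun s => sum_n_m (fun k => Cconj (c s) ^ k * A k (c s))%C 1 n).
  (* The curve lies in the disk for every parameter, so [F] may be replaced by the sum
     everywhere. *)
  - intros s. unfold circle_image. change (r * cos s, r * sin s) with (c s).
    rewrite HF by apply Hcd. reflexivity.
  - apply (is_Cderive_sum (fun k s => Cconj (c s) ^ k * A k (c s))%C du).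
    intros k Hk. apply (is_Cderive_mult (fun s => Cconj (c s) ^ k)%C (fun s => A k (c s))).
    + apply Hpow.
    + apply is_Cderive_comp; [apply analytic_at_smooth, Han, Hk | apply Hdc]. }
(* Monotonicity of the integral requires an integrable speed; continuity follows by differentiating
   the velocity once more, [ddu] being the derivative of [du]. *)
assert (Hdg : forall t, continuous (fun s => Cmod (dg s)) t).
{ intros t.
  pose (ddu := fun k t =>
    ((INR k * - Ci * (INR k * - Ci * Cconj (c t) ^ k)) * A k (c t)
     + INR k * - Ci * Cconj (c t) ^ k * (C_derive (A k) (c t) * (Ci * c t))
     + (INR k * - Ci * Cconj (c t) ^ k * (C_derive (A k) (c t) * (Ci * c t))
        + Cconj (c t) ^ k *
          (C_derive (C_derive (A k)) (c t) * (Ci * c t) * (Ci * c t)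
           + C_derive (A k) (c t) * (Ci * (Ci * c t)))))%C).
  apply is_Cderive_continuous_Cmod with (sum_n_m (fun k => ddu k t) 1 n).
  apply (is_Cderive_sum du ddu). intros k Hk.
  assert (Hlin : forall (a : C) f l, is_Cderive f t l -> is_Cderive (fun s => a * f s)%C t (a * l)%C).
  { intros a f l Hf. replace (a * l)%C with (0 * f t + a * l)%C by ring.
    apply (is_Cderive_mult (fun _ => a) f); [apply is_Cderive_const | exact Hf]. }
  apply is_Cderive_plus.
  - apply (is_Cderive_mult (fun s => INR k * - Ci * Cconj (c s) ^ k)%C (fun s => A k (c s))).
    + apply Hlin, Hpow.
    + apply is_Cderive_comp; [apply analytic_at_smooth, Han, Hk | apply Hdc].
  - apply (is_Cderive_mult (fun s => Cconj (c s) ^ k)%C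
             (fun s => C_derive (A k) (c s) * (Ci * c s))%C); [apply Hpow|].
    apply (is_Cderive_mult (fun s => C_derive (A k) (c s)) (fun s => Ci * c s)%C).
    + apply is_Cderive_comp; [apply analytic_at_smooth, analytic_at_C_derive, Han, Hk | apply Hdc].
    + apply Hlin, Hdc. }
set (b := M r * r / (1 - r) *
    ((1 + r) * (INR n * r ^ S n - INR (S n) * r ^ n + 1) / (1 - r) ^ 2 - 1 + r ^ n)).
unfold arclength, curve_length.
rewrite (RInt_ext _ (fun t => Cmod (dg t))).
2:{ intros t _. destruct (Hgamma t) as [H1 H2].
    apply is_derive_unique in H1. apply is_derive_unique in H2.
    transitivity (Cmod (Re (dg t), Im (dg t))).
    - f_equal. f_equal; assumption.
    - f_equal. symmetry. apply surjective_pairing. }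
assert (HPI := PI_RGT_0).
apply Rle_trans with (RInt (fun _ => b) 0 (2 * PI)).
- apply RInt_le; [lra| | |].
  + apply (ex_RInt_continuous (V := R_CompleteNormedModule)). intros; apply Hdg.
  + apply (ex_RInt_const (V := R_NormedModule)).
  + intros t _. apply Cmod_sum_weights; [exact Hr|]. intros k Hk.
    apply starlike_term_bound; [apply HA, Hk | lia | exact Hr | apply Hc |].
    apply HM; [exact Hk | apply Hc].
- rewrite RInt_const. right. unfold b. rewrite !S_INR.
  unfold scal; simpl; unfold mult; simpl. field. lra.
Qed.
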